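(* Let $M$ be a transitive model of ZF. In $M$, let $\mathbb{P}^*=\langle X,X^*,\le,\le^*\rangle$ be an extended coarsened poset satisfying the Left-Right Axiom, and assume that all cubes of $\langle X,\le\rangle$ are Ramsey. Let $N$ be a generic extension of $M$ by the forcing $\langle X,\le^*\rangle$ (which has the same separative quotient as $\langle X,\le\rangle$). Then $M$ and $N$ have the same sets of ordinals; moreover, every (ordinal-indexed) sequence in $N$ of elements of $M$ lies in $M$.
   Context: A coarsened poset is a triple $\langle X,\le,\le^*\rangle$ where $\le$ is a partial order and $\le^*$ is a quasi-order on $X$ such that (1) $x\le y$ implies $x\le^* y$; (2) if $y\le^* x$ then there is $z\le x$ with $z=^* y$, where $z=^*y$ means $z\le^* y$ and $y\le^* z$. For $x\in X$, $[x]=\{y\in X: y\le x\}$. An extended coarsened poset (EC poset) $\langle X,X^*,\le,\le^*\rangle$ consists of a coarsened poset $\langle X,\le,\le^*\rangle$ together with a quasi-ordered set $\langle X^*,\le^*\rangle$ such that $X\subseteq X^*$, the quasi-order on $X^*$ restricted to $X$ is the given $\le^*$ on $X$, and $\langle X,\le^*\rangle$ is dense in $\langle X^*,\le^*\rangle$. The EC poset satisfies the Left-Right Axiom (LRA) iff there are functions $\mathrm{Left},\mathrm{Right}:X^*\to X^*$ such that: (1) $\mathrm{Left}(x)\le^* x$ and $\mathrm{Right}(x)\le^* x$ for each $x\in X^*$; (2) for each $x\in X$ there are $y,z\in[x]$ with $\mathrm{Left}(y)=^*\mathrm{Right}(z)$ and $\mathrm{Right}(y)=^*\mathrm{Left}(z)$;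 (3) for each $p\in X$ and all $x,y\in[p]$ there is $z\in[p]$ with $\mathrm{Left}(z)\le^* x$, $\mathrm{Left}(\mathrm{Right}(z))\le^* x$ and $\mathrm{Right}(\mathrm{Right}(z))\le^* y$. All cubes of $\langle X,\le\rangle$ are Ramsey iff for every $x\in X$, every positive integer $k$ and every coloring $c:[x]\to k$ there is $y\le x$ such that $c\restriction[y]$ is constant.
   Formalization: The parenthetical ''which has the same separative quotient as ⟨X,≤⟩'' is left out; it fails in general: X=X*={a,b}, ≤ equality, ≤* total, Left=Right=id meets all the hypotheses, but ≤ gives two classes and ≤* one. *)

(* Defs.v *)
Set Implicit Arguments.
Unset Strict Implicit.
Unset Printing Implicit Defensive.

(** The ambient universe of sets.  Only extensionality and well-foundedness of
    membership are asked for, so that, up to isomorphism, it is an arbitrary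
    transitive class (Mostowski); no closure under set operations is assumed. *)
Record universe : Type := Universe {
  sets :> Type;
  mem : sets -> sets -> Prop;
  mem_ext : forall x y : sets, (forall z, mem z x <-> mem z y) -> x = y;
  mem_wf : well_founded mem
}.

Notation "x ∈ y" := (mem x y) (at level 70, no associativity).

(** First-order formulas of the language of set theory, in de Bruijn notation. *)
Inductive formula : Type :=
| f_mem (i j : nat)
| f_eq (i j : nat)
| f_not (phi : formula)
| f_and (phi psi : formula)
| f_all (phi : formula).

Definition scons (A : Type) (x : A) (rho : nat -> A) (i : nat) : A :=
  match i with O => x | S j => rho j end.

Section Models.
Variables (V : universe) (M : V -> Prop).

Fixpoint sat (rho : nat -> V) (phi : formula) : Prop :=
  match phi with
  | f_mem i j => rho i ∈ rho j
  | f_eq i j => rho i = rho j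
  | f_not phi => ~ sat rho phi
  | f_and phi psi => sat rho phi /\ sat rho psi
  | f_all phi => forall x, M x -> sat (scons x rho) phi
  end.

Definition transitive_class : Prop :=
  forall x y : V, M x -> y ∈ x -> M y.

(** [(M, ∈)] satisfies ZF.  The two schemes range over all first-order formulas
    with parameters [rho] from [M]. *)
Record models_ZF : Prop := ModelsZF {
  zf_extensionality : forall x y, M x -> M y ->
    (forall z, M z -> (z ∈ x <-> z ∈ y)) -> x = y;
  zf_foundation : forall x, M x -> (exists y, M y /\ y ∈ x) ->
    exists y, M y /\ y ∈ x /\ forall z, M z -> ~ (z ∈ x /\ z ∈ y);
  zf_pairing : forall x y, M x -> M y ->
    exists u, M u /\ forall z, M z -> (z ∈ u <-> z = x \/ z = y);
  zf_union : forall x, M x ->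
    exists u, M u /\
      forall z, M z -> (z ∈ u <-> exists y, M y /\ y ∈ x /\ z ∈ y);
  zf_power : forall x, M x ->
    exists u, M u /\
      forall y, M y -> (y ∈ u <-> forall z, M z -> z ∈ y -> z ∈ x);
  zf_infinity : exists w, M w /\
    (exists e, M e /\ e ∈ w /\ forall z, M z -> ~ z ∈ e) /\
    (forall x, M x -> x ∈ w ->
       exists s, M s /\ s ∈ w /\ forall z, M z -> (z ∈ s <-> z ∈ x \/ z = x));
  zf_separation : forall (phi : formula) (rho : nat -> V),
    (forall i, M (rho i)) -> forall a, M a ->
    exists b, M b /\
      forall x, M x -> (x ∈ b <-> x ∈ a /\ sat (scons x rho) phi);
  zf_replacement : forall (phi : formula) (rho : nat -> V),
    (forall i, M (rho i)) -> forall a, M a ->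
    (forall x, M x -> x ∈ a ->
       exists y, M y /\ sat (scons y (scons x rho)) phi /\
         forall y', M y' -> sat (scons y' (scons x rho)) phi -> y' = y) ->
    exists b, M b /\
      forall y, M y ->
        (y ∈ b <-> exists x, M x /\ x ∈ a /\ sat (scons y (scons x rho)) phi)
}.

End Models.

Section SetCoding.
Variable V : universe.

Definition elem (a : V) : V -> Prop := fun x => x ∈ a.

Definition is_upair (u x y : V) : Prop :=
  forall z, z ∈ u <-> z = x \/ z = y.

(** [e] is the Kuratowski pair of [x] and [y]. *)
Definition is_opair (e x y : V) : Prop :=
  exists a b, is_upair a x x /\ is_upair b x y /\ is_upair e a b.

(** The binary relation coded by [r]: the pair of [x] and [y] belongs to [r]. *)
Definition rel (r x y : V) : Prop := exists e, is_opair e x y /\ e ∈ r.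

(** [F] is the set-theoretic function [f] restricted to [A]. *)
Definition is_graph (A : V -> Prop) (f : V -> V) (F : V) : Prop :=
  (forall e, e ∈ F -> exists a, A a /\ is_opair e a (f a)) /\
  (forall a, A a -> exists e, is_opair e a (f a) /\ e ∈ F).

(** As membership is well-founded, linearity is all that has to be asked for
    in addition to transitivity. *)
Definition ordinal (a : V) : Prop :=
  (forall x y, x ∈ a -> y ∈ x -> y ∈ a) /\
  (forall x y, x ∈ a -> y ∈ a -> x ∈ y \/ x = y \/ y ∈ x).

(** The von Neumann natural numbers. *)
Inductive natural : V -> Prop :=
| natural_zero z : (forall x, ~ x ∈ z) -> natural z
| natural_succ n s :
    natural n -> (forall x, x ∈ s <-> x ∈ n \/ x = n) -> natural s.

End SetCoding.

Section Orders.
Variable T : Type.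
Implicit Types (A X Xs : T -> Prop) (r le les : T -> T -> Prop).

Definition quasi_order A r : Prop :=
  (forall x, A x -> r x x) /\
  (forall x y z, A x -> A y -> A z -> r x y -> r y z -> r x z).

Definition partial_order A r : Prop :=
  quasi_order A r /\ (forall x y, A x -> A y -> r x y -> r y x -> x = y).

Definition eqs les x y : Prop := les x y /\ les y x.

Definition cube X le x : T -> Prop := fun y => X y /\ le y x.

(** [D] is assumed to be contained in [A] wherever this is used. *)
Definition dense_in D A r : Prop := forall x, A x -> exists y, D y /\ r y x.

Record coarsened_poset X le les : Prop := CoarsenedPoset {
  cp_le : partial_order X le;
  cp_les : quasi_order X les;
  cp_coarser : forall x y, X x -> X y -> le x y -> les x y;
  cp_lift : forall x y, X x -> X y -> les y x ->
    exists z, X z /\ le z x /\ eqs les z y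
}.

(** One relation [les] serves on [Xs] and, by restriction, on [X]. *)
Record ec_poset X Xs le les : Prop := ECPoset {
  ec_coarsened : coarsened_poset X le les;
  ec_quasi : quasi_order Xs les;
  ec_sub : forall x, X x -> Xs x;
  ec_dense : dense_in X Xs les
}.

Record left_right X Xs le les (Left Right : T -> T) : Prop := LeftRight {
  lr_left : forall x, Xs x -> Xs (Left x);
  lr_right : forall x, Xs x -> Xs (Right x);
  lr_left_le : forall x, Xs x -> les (Left x) x;
  lr_right_le : forall x, Xs x -> les (Right x) x;
  lr_swap : forall x, X x -> exists y z,
    cube X le x y /\ cube X le x z /\
    eqs les (Left y) (Right z) /\ eqs les (Right y) (Left z);
  lr_split : forall p x y, X p -> cube X le p x -> cube X le p y ->
    exists z, cube X le p z /\
      les (Left z) x /\ les (Left (Right z)) x /\ les (Right (Right z)) y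
}.

Record filter A r (G : T -> Prop) : Prop := Filter {
  filter_sub : forall p, G p -> A p;
  filter_nonempty : exists p, G p;
  filter_up : forall p q, G p -> A q -> r p q -> G q;
  filter_down : forall p q, G p -> G q -> exists s, G s /\ r s p /\ r s q
}.

End Orders.

(** The two hypotheses below are relativized to [M]: the functions [Left] and
    [Right], and the colorings, are sets of [M]. *)
Section Relativized.
Variables (V : universe) (M : V -> Prop).

Definition left_right_axiom_in (X Xs : V) (le les : V -> V -> Prop) : Prop :=
  exists Left Right : V -> V,
    (exists L, M L /\ is_graph (elem Xs) Left L) /\
    (exists R, M R /\ is_graph (elem Xs) Right R) /\
    left_right (elem X) (elem Xs) le les Left Right.

Definition cubes_ramsey_in (X : V) (le : V -> V -> Prop) : Prop :=
  forall x k, x ∈ X -> M k -> natural k -> (exists i, i ∈ k) ->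
  forall c : V -> V,
    (forall y, cube (elem X) le x y -> c y ∈ k) ->
    (exists C, M C /\ is_graph (cube (elem X) le x) c C) ->
    exists y, cube (elem X) le x y /\
      forall u v, cube (elem X) le y u -> cube (elem X) le y v -> c u = c v.

End Relativized.

Section Forcing.
Variable V : universe.

(** Forcing names: sets of pairs of a name and a condition. *)
Inductive name (P : V) : V -> Prop :=
| Name t :
    (forall e, e ∈ t -> exists s p, is_opair e s p /\ name P s /\ p ∈ P) ->
    name P t.

(** [value G t x]: the set [x] is the evaluation of [t] by [G], that is,
    the set of the values of those [s] that are paired in [t] with some
    condition in [G].  By well-foundedness [t] has at most one value. *)
Inductive value (G : V -> Prop) : V -> V -> Prop :=
| Value t x :
    (forall s p, rel t s p -> G p -> exists y, y ∈ x /\ value G s y) ->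
    (forall y, y ∈ x -> exists s p, rel t s p /\ G p /\ value G s y) ->
    value G t x.

Definition generic_filter (M : V -> Prop) (P : V) (r : V -> V -> Prop)
    (G : V -> Prop) : Prop :=
  filter (elem P) r G /\
  forall D, M D -> (forall p, p ∈ D -> p ∈ P) ->
    dense_in (elem D) (elem P) r -> exists p, G p /\ p ∈ D.

(** [N] is [M[G]] for some [G] generic over [M]; smaller conditions are the
    stronger ones.  The second clause says that the ambient universe contains
    the values of all names. *)
Definition generic_extension (M : V -> Prop) (P : V) (r : V -> V -> Prop)
    (N : V -> Prop) : Prop :=
  exists G : V -> Prop,
    generic_filter M P r G /\
    (forall t, M t -> name P t -> exists x, value G t x) /\
    (forall x, N x <-> exists t, M t /\ name P t /\ value G t x).

End Forcing.

(* Main.v *)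
Require Import Defs.
From Stdlib Require Import Classical ClassicalEpsilon Lia PeanoNat.

Set Implicit Arguments.
Unset Strict Implicit.

(** Let [f] in [N] be a sequence of elements of [M], given by a name [t].  If one
    condition [q] of the generic filter answers all the questions what the value
    of [f] at [xi] is, then [f] is the set of those pairs which [q] forces into
    [t]; this set belongs to [M], because forcing is definable in [M].  A set of
    ordinals is treated in the same way, the questions being whether [xi] belongs
    to it.  So it has to be shown that below each condition [p], below which every
    single question can be answered, there is a [q] that answers all of them.

    No choice is available in [M], and the forcing need not be closed; the
    Left-Right Axiom and the Ramsey property take the place of that.  Color a
    condition [z] according to whether [Right z] decides at least as long an
    initial segment of the questions as [Left z] does, and let the color be
    constant on the cube of [q].

    - The color cannot always be negative: the swapping clause yields [y] and [z]
      such that, up to equivalence, [Left] and [Right] of [y] are [Right] and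
      [Left] of [z] ([not_homogeneous_complement]).
    - If the color is always positive, then [q] decides everything.  Otherwise let
      [i] be its first open question, and let [x] and [y] below [q] answer it
      differently.  For the [z] of the splitting clause, [Left z] is below [x] and
      so decides everything up to [i]; but [Right z] has elements below [x] and
      below [y] under it, so that it leaves [i] open ([homogeneous_decides]).

    This argument needs the coloring to be a set of [M], hence a formula for the
    forcing relation.  Formulas are produced from predicates on environments that
    are closed under the logical operations ([dfn]), and all recursive notions are
    greatest fixed points, approximated by sets of [M] ([gfp]).  Only statements
    of the form that a name has a given value in [M] have to be forced
    ([forces_value], [value_forces]); by [value_cover] they suffice to bring into
    [M] those ordinals and pairs of [N] which the questions are about. *)

(** * Deciding a well-ordered family of questions *)

Section Deciding.
Variables (T J A : Type) (X Xs : T -> Prop) (le les : T -> T -> Prop).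
Variables (Left Right : T -> T).
Hypotheses (EC : ec_poset X Xs le les) (LR : left_right X Xs le les Left Right).

(** [R p i v] means that [p] forces the answer [v] to the question [i]. *)
Variables (I : J -> Prop) (lt : J -> J -> Prop) (R : T -> J -> A -> Prop).
Hypotheses (lt_wf : well_founded lt)
  (lt_trans : forall i j k, I i -> I j -> I k -> lt i j -> lt j k -> lt i k)
  (lt_total : forall i j, I i -> I j -> lt i j \/ i = j \/ lt j i).
Hypotheses
  (R_mono : forall p q i v, X p -> X q -> les q p -> R p i v -> R q i v)
  (R_unique : forall p i v w, X p -> I i -> R p i v -> R p i w -> v = w)
  (R_local : forall p i v, X p ->
    (forall q, X q -> les q p -> exists r, X r /\ les r q /\ R r i v) -> R p i v).

(** [Left z] and [Right z] need not be conditions, so that [R] does not apply to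
    them; the agreement of all conditions below makes sense for elements of [Xs],
    and for conditions it amounts to [R] itself. *)
Definition decides (r : T) (i : J) : Prop :=
  exists v, forall q, X q -> les q r -> R q i v.

Definition decides_upto (r : T) (i : J) : Prop :=
  decides r i /\ forall j, I j -> lt j i -> decides r j.

(** As the questions are well-ordered, this says that the first question which
    [Right z] leaves open does not come before the one which [Left z] leaves
    open. *)
Definition left_below_right (z : T) : Prop :=
  forall i, I i -> decides_upto (Left z) i -> decides_upto (Right z) i.

Lemma les_trans x y z : Xs x -> Xs y -> Xs z -> les x y -> les y z -> les x z.
Proof. apply (ec_quasi EC). Qed.

Lemma les_refl x : Xs x -> les x x.
Proof. apply (ec_quasi EC). Qed.

Lemma X_Xs x : X x -> Xs x.
Proof. apply (ec_sub EC). Qed.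

Lemma le_les x y : X x -> X y -> le x y -> les x y.
Proof. apply (cp_coarser (ec_coarsened EC)). Qed.

Lemma cube_refl x : X x -> cube X le x x.
Proof. intros Hx. split; [exact Hx|]. now apply (cp_le (ec_coarsened EC)). Qed.

Lemma decides_mono r r' i : Xs r -> Xs r' -> les r' r -> decides r i -> decides r' i.
Proof.
  intros Hr Hr' Hrr' (v & Hv). exists v. intros q Hq Hqr. apply Hv; [exact Hq|].
  exact (les_trans (X_Xs Hq) Hr' Hr Hqr Hrr').
Qed.

Lemma decides_intro p i v : X p -> R p i v -> decides p i.
Proof. intros Hp H. exists v. intros q Hq Hqp. exact (R_mono Hp Hq Hqp H). Qed.

Lemma decides_elim p i : X p -> decides p i -> exists v, R p i v.
Proof.
  intros Hp (v & Hv). exists v. apply Hv; [exact Hp|exact (les_refl (X_Xs Hp))].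
Qed.

Lemma decides_upto_mono r r' i : Xs r -> Xs r' -> les r' r ->
  decides_upto r i -> decides_upto r' i.
Proof. intros Hr Hr' H [H1 H2]. split; eauto using decides_mono. Qed.

Lemma decides_upto_lt r i j : I i -> I j -> lt j i ->
  decides_upto r i -> decides_upto r j.
Proof. intros Hi Hj Hji [H1 H2]. split; eauto. Qed.

Lemma decides_upto_comparable r r' i : I i ->
  decides_upto r i -> ~ decides_upto r' i ->
  forall j, I j -> decides_upto r' j -> decides_upto r j.
Proof.
  intros Hi H N j Hj Hj'. destruct (lt_total Hi Hj) as [K|[->|K]].
  - destruct (N (decides_upto_lt Hj Hi K Hj')).
  - exact H.
  - exact (decides_upto_lt Hi Hj K H).
Qed.

Lemma split_undecided p q i : X p ->
  (forall r, X r -> les r p -> exists r' v, X r' /\ les r' r /\ R r' i v) ->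
  X q -> les q p -> ~ decides q i ->
  exists x y v w, X x /\ X y /\ les x q /\ les y q /\ R x i v /\ R y i w /\ v <> w.
Proof.
  intros Hp Dense Hq Hqp N.
  destruct (Dense q Hq Hqp) as (x & v & Hx & Hxq & Rx).
  apply NNPP. intros N'. apply N. apply (decides_intro (v := v)); [exact Hq|].
  apply R_local; [exact Hq|]. intros y Hy Hyq.
  assert (Hyp := les_trans (X_Xs Hy) (X_Xs Hq) (X_Xs Hp) Hyq Hqp).
  destruct (Dense y Hy Hyp) as (y' & w & Hy' & Hyy' & Ry).
  exists y'. split; [exact Hy'|]; split; [exact Hyy'|].
  assert (Hy'q := les_trans (X_Xs Hy') (X_Xs Hy) (X_Xs Hq) Hyy' Hyq).
  replace v with w; [exact Ry|].
  apply NNPP. intros Nvw. apply N'. exists x, y', v, w.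
  repeat (split; [assumption|]). congruence.
Qed.

(** Density of [X] turns the common lower bounds in [Xs] into conditions, on which
    the answers of [r], [x] and [y] have to agree. *)
Lemma decides_common r i x y v w : Xs r -> I i -> X x -> X y ->
  R x i v -> R y i w -> decides r i ->
  (exists a, Xs a /\ les a r /\ les a x) ->
  (exists b, Xs b /\ les b r /\ les b y) -> v = w.
Proof.
  intros Hr Hi Hx Hy Rx Ry (u & Hu).
  assert (Agree : forall x v, X x -> R x i v ->
    (exists a, Xs a /\ les a r /\ les a x) -> v = u).
  { intros x' v' Hx' Rx' (a & Ha & Har & Hax).
    destruct (ec_dense EC Ha) as (c & Hc & Hca).
    assert (Hcr := les_trans (X_Xs Hc) Ha Hr Hca Har).
    assert (Hcx := les_trans (X_Xs Hc) Ha (X_Xs Hx') Hca Hax).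
    apply (R_unique Hc Hi); [exact (R_mono Hx' Hc Hcx Rx')|exact (Hu c Hc Hcr)]. }
  intros Kx Ky. now rewrite (Agree x v Hx Rx Kx), (Agree y w Hy Ry Ky).
Qed.

(** A first open question [i] of [q] would be open in [Right z], which lies above
    conditions that answer it differently, but not in [Left z], where [z] comes
    from the splitting clause of the Left-Right Axiom. *)
Lemma homogeneous_decides p q : X p -> cube X le p q ->
  (forall i, I i -> forall r, X r -> les r p ->
     exists r' v, X r' /\ les r' r /\ R r' i v) ->
  (forall z, cube X le q z -> left_below_right z) ->
  forall i, I i -> decides q i.
Proof.
  intros Hp [Hq Hqp] Dense Hom i. assert (Hqp' := le_les Hq Hp Hqp).
  induction (lt_wf i) as [i _ IH]. intros Hi. apply NNPP. intros N.
  destruct (split_undecided Hp (Dense i Hi) Hq Hqp' N)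
    as (x & y & v & w & Hx & Hy & Hxq & Hyq & Rx & Ry & Nvw).
  destruct (cp_lift (ec_coarsened EC) Hq Hx Hxq) as (x' & Hx' & Hx'q & Ex & _).
  destruct (cp_lift (ec_coarsened EC) Hq Hy Hyq) as (y' & Hy' & Hy'q & Ey & _).
  assert (Rx' := R_mono Hx Hx' Ex Rx). assert (Ry' := R_mono Hy Hy' Ey Ry).
  destruct (lr_split LR Hq (conj Hx' Hx'q) (conj Hy' Hy'q))
    as (z & Hzq & L1 & L2 & L3).
  assert (Xz := X_Xs (proj1 Hzq)).
  assert (Lz := lr_left LR Xz). assert (Rz := lr_right LR Xz).
  assert (Hzq' := le_les (proj1 Hzq) Hq (proj2 Hzq)).
  assert (Lzq := les_trans Lz Xz (X_Xs Hq) (lr_left_le LR Xz) Hzq').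
  assert (K : decides_upto (Right z) i).
  { apply (Hom z Hzq i Hi). split.
    - apply (decides_mono (X_Xs Hx') Lz L1). exact (decides_intro Hx' Rx').
    - intros j Hj Hji. apply (decides_mono (X_Xs Hq) Lz Lzq). exact (IH j Hji Hj). }
  apply Nvw. apply (decides_common Rz Hi Hx' Hy' Rx' Ry' (proj1 K)).
  - exists (Left (Right z)). split; [exact (lr_left LR Rz)|].
    split; [exact (lr_left_le LR Rz)|exact L2].
  - exists (Right (Right z)). split; [exact (lr_right LR Rz)|].
    split; [exact (lr_right_le LR Rz)|exact L3].
Qed.

(** Wherever [left_below_right] fails, [Right] decides strictly less than [Left].
    For the pair from the swapping clause of the Left-Right Axiom this would make
    each of two elements decide strictly less than the other. *)
Lemma not_homogeneous_complement q : X q ->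
  ~ (forall z, cube X le q z -> ~ left_below_right z).
Proof.
  intros Hq Hom.
  destruct (lr_swap LR Hq) as (y & z & Hy & Hz & [_ E1] & [E2 _]).
  assert (Xy := X_Xs (proj1 Hy)). assert (Xz := X_Xs (proj1 Hz)).
  assert (Ly := lr_left LR Xy). assert (Ry := lr_right LR Xy).
  assert (Lz := lr_left LR Xz). assert (Rz := lr_right LR Xz).
  apply (Hom y Hy). intros i Hi Ki. apply NNPP. intros Ni.
  apply (Hom z Hz). intros j Hj Kj.
  apply (decides_upto_mono Ly Rz E1).
  apply (decides_upto_comparable Hi Ki Ni Hj).
  exact (decides_upto_mono Lz Ry E2 Kj).
Qed.

End Deciding.
(** * Definable classes *)

Section Definability.
Variables (V : universe) (M : V -> Prop).

Fixpoint rename (f : nat -> nat) (phi : formula) : formula :=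
  match phi with
  | f_mem i j => f_mem (f i) (f j)
  | f_eq i j => f_eq (f i) (f j)
  | f_not phi => f_not (rename f phi)
  | f_and phi psi => f_and (rename f phi) (rename f psi)
  | f_all phi =>
      f_all (rename (fun i => match i with O => O | S j => S (f j) end) phi)
  end.

Lemma sat_rename phi : forall f (rho rho' : nat -> V),
  (forall i, rho (f i) = rho' i) ->
  (sat M rho (rename f phi) <-> sat M rho' phi).
Proof.
  induction phi as [i j|i j|phi IH|phi IH1 psi IH2|phi IH]; intros f rho rho' H;
    simpl.
  - rewrite !H; tauto.
  - rewrite !H; tauto.
  - rewrite (IH _ _ _ H); tauto.
  - rewrite (IH1 _ _ _ H), (IH2 _ _ _ H); tauto.
  - split; intros K x Mx; specialize (K x Mx);
      (eapply IH; [|exact K]) || (eapply IH in K; [exact K|]);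
      intros [|i]; simpl; auto.
Qed.

Inductive term : Type := t_var (i : nat) | t_const (c : V).

Definition eval (rho : nat -> V) (t : term) : V :=
  match t with t_var i => rho i | t_const c => c end.

Definition term_in (t : term) : Prop :=
  match t with t_var i => True | t_const c => M c end.

Definition env_in (rho : nat -> V) : Prop := forall i, M (rho i).

(** What may stand at a place of an atomic formula: a variable, or a parameter
    from [M]. *)
Definition tm (a : (nat -> V) -> V) : Prop :=
  exists t, term_in t /\ forall rho, eval rho t = a rho.

(** Only environments from [M] matter, so that a quantifier that is bounded by
    a set of [M] may be read as ranging over [M].  The terms [tau] make room
    for parameters from [M] at arbitrary places; this is what allows binders
    and conjunctions to be treated without a syntax of parameters. *)
Definition dfn (R : (nat -> V) -> Prop) : Prop :=
  exists phi (tau : nat -> term), (forall n, term_in (tau n)) /\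
    forall rho, env_in rho ->
      (sat M (fun n => eval rho (tau n)) phi <-> R rho).

Lemma tm_var i : tm (fun rho => rho i).
Proof. exists (t_var i); simpl; auto. Qed.

Lemma tm_const c : M c -> tm (fun _ => c).
Proof. exists (t_const c); simpl; auto. Qed.

Lemma tm_shift a (f : nat -> nat) :
  tm a -> tm (fun rho => a (fun i => rho (f i))).
Proof.
  intros [[i|c] [Ht H]]; simpl in *.
  - exists (t_var (f i)); split; [exact I|]. intros rho; simpl.
    exact (H (fun i => rho (f i))).
  - exists (t_const c); split; [exact Ht|]. intros rho; simpl.
    exact (H (fun i => rho (f i))).
Qed.

Lemma dfn_ext (R R' : (nat -> V) -> Prop) :
  (forall rho, env_in rho -> (R rho <-> R' rho)) -> dfn R -> dfn R'.
Proof.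
  intros H (phi & tau & Ht & K). exists phi, tau; split; [exact Ht|].
  intros rho Hr. rewrite <- (H _ Hr). auto.
Qed.

Lemma dfn_mem a b : tm a -> tm b -> dfn (fun rho => a rho ∈ b rho).
Proof.
  intros (s & Ms & Hs) (t & Mt & Ht).
  exists (f_mem 0 1), (fun n => match n with O => s | _ => t end); split.
  - intros [|n]; auto.
  - intros rho _; simpl. rewrite Hs, Ht. tauto.
Qed.

Lemma dfn_eq a b : tm a -> tm b -> dfn (fun rho => a rho = b rho).
Proof.
  intros (s & Ms & Hs) (t & Mt & Ht).
  exists (f_eq 0 1), (fun n => match n with O => s | _ => t end); split.
  - intros [|n]; auto.
  - intros rho _; simpl. rewrite Hs, Ht. tauto.
Qed.

Lemma dfn_not R : dfn R -> dfn (fun rho => ~ R rho).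
Proof.
  intros (phi & tau & Ht & H). exists (f_not phi), tau; split; [exact Ht|].
  intros rho Hr; simpl. rewrite (H _ Hr). tauto.
Qed.

(* The parameters of the two formulas are put at the even and the odd places. *)
Lemma dfn_and R R' : dfn R -> dfn R' -> dfn (fun rho => R rho /\ R' rho).
Proof.
  intros (phi & tau & Ht & H) (phi' & tau' & Ht' & H').
  exists (f_and (rename (fun n => n + n) phi) (rename (fun n => S (n + n)) phi')),
    (fun n => if Nat.even n then tau (Nat.div2 n) else tau' (Nat.div2 n)).
  split.
  - intros n. destruct (Nat.even n); auto.
  - assert (E : forall n, Nat.even (n + n) = true /\ Nat.div2 (n + n) = n /\
      Nat.even (S (n + n)) = false /\ Nat.div2 (S (n + n)) = n).
    { intros n. replace (n + n) with (2 * n) by lia.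
      rewrite Nat.even_succ, <- Nat.negb_even, Nat.even_mul.
      rewrite Nat.div2_succ_double, Nat.div2_double. auto. }
    intros rho Hr; simpl. rewrite <- (H _ Hr), <- (H' _ Hr).
    apply Morphisms_Prop.and_iff_morphism; apply sat_rename; intros n;
      destruct (E n) as (e1 & e2 & e3 & e4).
    + now rewrite e1, e2.
    + now rewrite e3, e4.
Qed.

(** [bind_index] and [bind_term] prepare a formula for a quantifier: places that
    hold the variable to be bound are sent to place 0, all others move up by
    one. *)
Definition bind_index (tau : nat -> term) (n : nat) : nat :=
  match tau n with t_var O => O | _ => S n end.

Definition bind_term (t : term) : term :=
  match t with t_var (S i) => t_var i | t => t end.

Lemma sat_bind phi tau x rho :
  sat M (scons x (fun n => eval rho (bind_term (tau n))))
    (rename (bind_index tau) phi) <->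
  sat M (fun n => eval (scons x rho) (tau n)) phi.
Proof.
  apply sat_rename. intros n. unfold bind_index.
  destruct (tau n) as [[|i]|c] eqn:E; simpl; rewrite ?E; reflexivity.
Qed.

Lemma bind_term_in t : term_in t -> term_in (bind_term t).
Proof. destruct t as [[|i]|c]; simpl; auto. Qed.

Lemma env_in_scons x rho : M x -> env_in rho -> env_in (scons x rho).
Proof. intros Mx Hr [|i]; simpl; auto. Qed.

Lemma dfn_all (R : V -> (nat -> V) -> Prop) :
  dfn (fun rho => R (rho 0) (fun i => rho (S i))) ->
  dfn (fun rho => forall x, M x -> R x rho).
Proof.
  intros (phi & tau & Ht & H).
  exists (f_all (rename (bind_index tau) phi)), (fun n => bind_term (tau n)).
  split.
  - intros n. apply bind_term_in, Ht.
  - intros rho Hr; simpl. split; intros K x Mx; specialize (K x Mx).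
    + apply sat_bind in K. apply H in K; [exact K|now apply env_in_scons].
    + apply sat_bind. apply H; [now apply env_in_scons|exact K].
Qed.

Lemma dfn_imp R R' : dfn R -> dfn R' -> dfn (fun rho => R rho -> R' rho).
Proof.
  intros H H'.
  apply (dfn_ext (R := fun rho => ~ (R rho /\ ~ R' rho))).
  - intros rho _. tauto.
  - now apply dfn_not, dfn_and, dfn_not.
Qed.

Lemma dfn_or R R' : dfn R -> dfn R' -> dfn (fun rho => R rho \/ R' rho).
Proof.
  intros H H'.
  apply (dfn_ext (R := fun rho => ~ R rho -> R' rho)).
  - intros rho _. tauto.
  - now apply dfn_imp; [apply dfn_not|].
Qed.

Lemma dfn_ex (R : V -> (nat -> V) -> Prop) :
  dfn (fun rho => R (rho 0) (fun i => rho (S i))) ->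
  dfn (fun rho => exists x, M x /\ R x rho).
Proof.
  intros H.
  apply (dfn_ext (R := fun rho => ~ forall x, M x -> ~ R x rho)).
  - intros rho _. split.
    + intros K. apply NNPP. intros N. apply K. intros x Mx Rx. eauto.
    + intros (x & Mx & Rx) K. eapply K; eauto.
  - apply dfn_not. apply (dfn_all (R := fun x rho => ~ R x rho)).
    now apply dfn_not.
Qed.

Hypothesis M_transitive : transitive_class M.

Lemma tm_in a rho : tm a -> env_in rho -> M (a rho).
Proof.
  intros ([i|c] & Ht & H) Hr; rewrite <- H; simpl in *; auto.
Qed.

Lemma dfn_subst (D : V -> Prop) a :
  dfn (fun rho => D (rho 0)) -> tm a -> dfn (fun rho => D (a rho)).
Proof.
  intros (phi & tau & Ht & H) Ha. assert (Ma := fun rho => @tm_in a rho Ha).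
  destruct Ha as (t & Mt & Et).
  exists (rename (fun n => n) phi),
    (fun n => match tau n with t_var _ => t | t_const c => t_const c end).
  split.
  - intros n. specialize (Ht n). destruct (tau n); simpl; auto.
  - intros rho Hr. rewrite <- (H (fun _ => a rho)); [|intros _; auto].
    apply sat_rename. intros n. destruct (tau n); simpl; auto.
Qed.

Lemma dfn_ball a (R : V -> (nat -> V) -> Prop) : tm a ->
  dfn (fun rho => R (rho 0) (fun i => rho (S i))) ->
  dfn (fun rho => forall x, x ∈ a rho -> R x rho).
Proof.
  intros Ha H.
  apply (dfn_ext (R := fun rho => forall x, M x -> x ∈ a rho -> R x rho)).
  - intros rho Hr. split; intros K x; intros; apply K; auto.
    apply M_transitive with (a rho); auto using tm_in.
  - apply (dfn_all (R := fun x rho => x ∈ a rho -> R x rho)).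
    apply dfn_imp; [|exact H].
    apply dfn_mem; [apply tm_var|exact (tm_shift S Ha)].
Qed.

Lemma dfn_bex a (R : V -> (nat -> V) -> Prop) : tm a ->
  dfn (fun rho => R (rho 0) (fun i => rho (S i))) ->
  dfn (fun rho => exists x, x ∈ a rho /\ R x rho).
Proof.
  intros Ha H.
  apply (dfn_ext (R := fun rho => exists x, M x /\ x ∈ a rho /\ R x rho)).
  - intros rho Hr. split; intros (x & K); exists x; [tauto|].
    split; [|tauto]. apply M_transitive with (a rho); auto using tm_in.
    tauto.
  - apply (dfn_ex (R := fun x rho => x ∈ a rho /\ R x rho)).
    apply dfn_and; [|exact H].
    apply dfn_mem; [apply tm_var|exact (tm_shift S Ha)].
Qed.

(** Closure under substitution of terms is built in, because these relations are
    applied below quantifiers. *)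
Definition def2 (K : V -> V -> Prop) : Prop := forall a b,
  tm a -> tm b -> dfn (fun rho => K (a rho) (b rho)).
Definition def3 (K : V -> V -> V -> Prop) : Prop := forall a b c,
  tm a -> tm b -> tm c -> dfn (fun rho => K (a rho) (b rho) (c rho)).
Definition def4 (K : V -> V -> V -> V -> Prop) : Prop := forall w a b c,
  tm w -> tm a -> tm b -> tm c ->
  dfn (fun rho => K (w rho) (a rho) (b rho) (c rho)).

End Definability.

Ltac tm_tac :=
  first [ apply tm_var
        | apply tm_const; assumption
        | eassumption
        | eapply tm_shift; eassumption ].

(* Relations that are known to be definable, and should not be unfolded; the list
   grows along the way. *)
Ltac dfn_known := fail.

Ltac dfn_tac :=
  cbv beta;
  lazymatch goal with
  | |- tm _ _ => tm_tac
  | |- dfn _ _ =>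
    first [ assumption
          | dfn_known; dfn_tac
          | apply dfn_mem; dfn_tac
          | apply dfn_eq; dfn_tac
          | apply dfn_and; dfn_tac
          | apply dfn_or; dfn_tac
          | apply dfn_not; dfn_tac
          | apply dfn_all; dfn_tac
          | apply dfn_ball; [assumption|dfn_tac|dfn_tac]
          | apply dfn_ex; dfn_tac
          | apply dfn_bex; [assumption|dfn_tac|dfn_tac]
          | apply dfn_imp; dfn_tac
          | idtac ]
  | |- _ => try assumption
  end.

(** * Sets of the model *)

Section Model.
Variables (V : universe) (M : V -> Prop).
Hypotheses (M_transitive : transitive_class M) (M_ZF : models_ZF M).
Implicit Types a b c e p s t u x y z A B C T W : V.

Lemma in_M x y : M x -> y ∈ x -> M y.
Proof. apply M_transitive. Qed.

Lemma separation (R : V -> Prop) a : dfn M (fun rho => R (rho 0)) -> M a ->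
  exists b, M b /\ forall x, x ∈ b <-> x ∈ a /\ R x.
Proof.
  intros (phi & tau & Ht & H) Ma.
  set (rho := fun n => eval (fun _ => a) (bind_term (tau n))).
  assert (Hr : env_in M rho).
  { intros n. unfold rho. pose proof (bind_term_in (Ht n)) as K.
    destruct (bind_term (tau n)); simpl in *; auto. }
  destruct (zf_separation M_ZF (rename (bind_index tau) phi) Hr Ma)
    as (b & Mb & Hb).
  exists b; split; [exact Mb|]. intros x.
  assert (K : M x -> (x ∈ b <-> x ∈ a /\ R x)).
  { intros Mx. rewrite (Hb x Mx). unfold rho. rewrite sat_bind.
    rewrite H; [reflexivity|]. apply env_in_scons; [exact Mx|]. intros _; auto. }
  split.
  - intros Hx. apply K; [exact (in_M Mb Hx)|exact Hx].
  - intros Hx. apply K; [exact (in_M Ma (proj1 Hx))|exact Hx].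
Qed.

Lemma replacement (R : V -> V -> Prop) a :
  dfn M (fun rho => R (rho 1) (rho 0)) -> M a ->
  (forall x, x ∈ a -> exists y, M y /\ R x y) ->
  (forall x y y', x ∈ a -> M y -> M y' -> R x y -> R x y' -> y = y') ->
  exists b, M b /\ forall y, y ∈ b <-> M y /\ exists x, x ∈ a /\ R x y.
Proof.
  intros (phi & tau & Ht & H) Ma Ex Un.
  set (tau1 := fun n => bind_term (tau n)).
  set (rho := fun n => eval (fun _ => a) (bind_term (tau1 n))).
  set (up := fun i => match i with O => O | S j => S (bind_index tau1 j) end).
  set (psi := rename up (rename (bind_index tau) phi)).
  assert (Hr : env_in M rho).
  { intros n. unfold rho, tau1.
    pose proof (bind_term_in (bind_term_in (Ht n))) as K.
    destruct (bind_term (bind_term (tau n))); simpl in *; auto. }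
  assert (E : forall x y, M x -> M y ->
    (sat M (scons y (scons x rho)) psi <-> R x y)).
  { intros x y Mx My. unfold psi.
    rewrite (@sat_rename _ _ _ _ _
      (scons y (fun n => eval (scons x (fun _ => a)) (tau1 n)))).
    - unfold tau1. rewrite sat_bind. rewrite H; [reflexivity|].
      repeat apply env_in_scons; auto. intros _; auto.
    - intros [|n]; [reflexivity|]. simpl. unfold rho, bind_index.
      destruct (tau1 n) as [[|i]|c] eqn:En; simpl; rewrite ?En; reflexivity. }
  destruct (@zf_replacement V M M_ZF psi rho Hr a Ma) as (b & Mb & Hb).
  { intros x Mx Hx. destruct (Ex x Hx) as (y & My & Rxy).
    exists y; split; [exact My|]; split; [now apply E|].
    intros y' My' Ry'. apply E in Ry'; auto. exact (Un x y' y Hx My' My Ry' Rxy). }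
  exists b; split; [exact Mb|]. intros y. split.
  - intros Hy. pose proof (in_M Mb Hy) as My. split; [exact My|].
    apply Hb in Hy; [|exact My]. destruct Hy as (x & Mx & Hx & K).
    apply E in K; eauto.
  - intros (My & x & Hx & K). pose proof (in_M Ma Hx) as Mx.
    apply Hb; [exact My|]. exists x. rewrite E; auto.
Qed.

Lemma pairing x y : M x -> M y -> exists u, M u /\ is_upair u x y.
Proof.
  intros Mx My. destruct (zf_pairing M_ZF Mx My) as (u & Mu & Hu).
  exists u; split; [exact Mu|]. intros z. split.
  - intros Hz. apply Hu; [exact (in_M Mu Hz)|exact Hz].
  - intros Hz. apply Hu; [|exact Hz]. destruct Hz as [->| ->]; auto.
Qed.

Lemma union x : M x ->
  exists u, M u /\ forall z, z ∈ u <-> exists y, y ∈ x /\ z ∈ y.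
Proof.
  intros Mx. destruct (zf_union M_ZF Mx) as (u & Mu & Hu).
  exists u; split; [exact Mu|]. intros z. split.
  - intros Hz. apply Hu in Hz; [|exact (in_M Mu Hz)].
    destruct Hz as (y & _ & K); eauto.
  - intros (y & Hy & Hz). pose proof (in_M Mx Hy) as My.
    apply Hu; [exact (in_M My Hz)|]. eauto.
Qed.

Lemma power x : M x ->
  exists u, M u /\ forall y, M y -> (forall z, z ∈ y -> z ∈ x) -> y ∈ u.
Proof.
  intros Mx. destruct (zf_power M_ZF Mx) as (u & Mu & Hu).
  exists u; split; [exact Mu|]. intros y My H. apply Hu; auto.
Qed.

Lemma union2 x y : M x -> M y ->
  exists u, M u /\ forall z, z ∈ u <-> z ∈ x \/ z ∈ y.
Proof.
  intros Mx My. destruct (pairing Mx My) as (w & Mw & Hw).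
  destruct (union Mw) as (u & Mu & Hu). exists u; split; [exact Mu|].
  intros z. rewrite Hu. split.
  - intros (v & Hv & Hz). apply Hw in Hv. destruct Hv as [->| ->]; auto.
  - intros [Hz|Hz]; [exists x|exists y]; split; auto; apply Hw; auto.
Qed.

Lemma dfn_upair : def3 M (@is_upair V).
Proof.
  intros u x y Hu Hx Hy.
  apply (dfn_ext (R := fun rho => x rho ∈ u rho /\ y rho ∈ u rho /\
    forall z, z ∈ u rho -> z = x rho \/ z = y rho)); [|dfn_tac].
  intros rho Hr. unfold is_upair. split.
  - intros (Kx & Ky & K) z. split; [apply K|]. intros [->| ->]; auto.
  - intros K. repeat split; intros; apply K; auto.
Qed.

Lemma dfn_opair : def3 M (@is_opair V).
Proof.
  intros e x y He Hx Hy.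
  apply (dfn_ext (R := fun rho => exists a, a ∈ e rho /\ exists b, b ∈ e rho /\
    is_upair a (x rho) (x rho) /\ is_upair b (x rho) (y rho) /\
    is_upair (e rho) a b)).
  - intros rho Hr. unfold is_opair. split.
    + intros (a & _ & b & _ & K). eauto.
    + intros (a & b & K1 & K2 & K3).
      exists a. split; [apply K3; auto|]. exists b. split; [apply K3; auto|]. auto.
  - dfn_tac; apply dfn_upair; dfn_tac.
Qed.

Lemma upair_unique u u' x y : is_upair u x y -> is_upair u' x y -> u = u'.
Proof. intros H H'. apply mem_ext. intros z. rewrite (H z), (H' z). tauto. Qed.

Lemma opair_unique e e' x y : is_opair e x y -> is_opair e' x y -> e = e'.
Proof.
  intros (a & b & Ha & Hb & He) (a' & b' & Ha' & Hb' & He').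
  rewrite (upair_unique Ha Ha') in He. rewrite (upair_unique Hb Hb') in He.
  exact (upair_unique He He').
Qed.

Lemma opair_inj e x y x' y' : is_opair e x y -> is_opair e x' y' ->
  x = x' /\ y = y'.
Proof.
  intros (a & b & Ha & Hb & He) (a' & b' & Ha' & Hb' & He').
  assert (Ea : a' = a \/ a' = b) by (apply He, He'; auto).
  assert (Eb : b' = a \/ b' = b) by (apply He, He'; auto).
  assert (Fb : b = a' \/ b = b') by (apply He', He; auto).
  assert (Xx : x = x').
  { assert (x ∈ a') by (destruct Ea as [->| ->]; [apply Ha|apply Hb]; auto).
    apply Ha' in H. tauto. }
  subst x'. split; [reflexivity|].
  pose proof (upair_unique Ha Ha') as E. subst a'.
  assert (Hy : y ∈ b) by (apply Hb; auto).
  assert (Hy' : y' ∈ b') by (apply Hb'; auto).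
  destruct Fb as [E|E].
  - subst b. apply Ha in Hy. assert (y = x) by tauto. subst y.
    assert (b' = a) by tauto. subst b'. apply Ha in Hy'.
    destruct Hy' as [->| ->]; reflexivity.
  - subst b'. apply Hb in Hy'. apply Hb' in Hy.
    destruct Hy' as [->|E']; [|congruence]. destruct Hy; auto.
Qed.

Lemma opair_M e x y : is_opair e x y -> M e -> M x /\ M y.
Proof.
  intros (a & b & Ha & Hb & He) Me.
  assert (Mb : M b) by (apply (in_M Me), He; auto).
  split; apply (in_M Mb), Hb; auto.
Qed.

Lemma opair_in_M e x y : is_opair e x y -> M x -> M y -> M e.
Proof.
  intros (a & b & Ha & Hb & He) Mx My.
  destruct (pairing Mx Mx) as (a' & Ma & Ha').
  destruct (pairing Mx My) as (b' & Mb & Hb').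
  rewrite (upair_unique Ha Ha'), (upair_unique Hb Hb') in He.
  destruct (pairing Ma Mb) as (e' & Me & He').
  now rewrite (upair_unique He He').
Qed.

Lemma opair_exists x y : M x -> M y -> exists e, M e /\ is_opair e x y.
Proof.
  intros Mx My.
  destruct (pairing Mx Mx) as (a & Ma & Ha).
  destruct (pairing Mx My) as (b & Mb & Hb).
  destruct (pairing Ma Mb) as (e & Me & He).
  exists e; split; [exact Me|]. exists a, b; auto.
Qed.

Lemma dfn_rel : def3 M (@rel V).
Proof.
  intros r x y Hr Hx Hy.
  apply (dfn_ext (R := fun rho => exists e, e ∈ r rho /\
    is_opair e (x rho) (y rho))).
  - intros rho _. split; intros (e & K1 & K2); exists e; auto.
  - dfn_tac. apply dfn_opair; dfn_tac.
Qed.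

Lemma rel_M r x y : M r -> rel r x y -> M x /\ M y.
Proof. intros Mr (e & He & Hr). exact (opair_M He (in_M Mr Hr)). Qed.

Lemma pairs_bound T : M T -> exists Q, M Q /\
  forall e x y, is_opair e x y -> x ∈ T -> y ∈ T -> e ∈ Q.
Proof.
  intros MT. destruct (power MT) as (T1 & MT1 & H1).
  destruct (power MT1) as (T2 & MT2 & H2).
  exists T2; split; [exact MT2|]. intros e x y Hp Hx Hy.
  apply H2; [exact (opair_in_M Hp (in_M MT Hx) (in_M MT Hy))|].
  destruct Hp as (a & b & Ha & Hb & He). intros z Hz.
  assert (Mx := in_M MT Hx). assert (My := in_M MT Hy).
  apply He in Hz. destruct Hz as [->| ->]; apply H1.
  - destruct (pairing Mx Mx) as (a' & Ma & Ha').
    now rewrite (upair_unique Ha Ha').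
  - intros z Hz. apply Ha in Hz. destruct Hz as [->| ->]; auto.
  - destruct (pairing Mx My) as (b' & Mb & Hb').
    now rewrite (upair_unique Hb Hb').
  - intros z Hz. apply Hb in Hz. destruct Hz as [->| ->]; auto.
Qed.

Definition trans T : Prop := forall x y, x ∈ T -> y ∈ x -> y ∈ T.

Lemma rel_trans T r x y : trans T -> r ∈ T -> rel r x y -> x ∈ T /\ y ∈ T.
Proof.
  intros HT Hr (e & (a & b & Ha & Hb & He) & Her).
  assert (Hb' : b ∈ T).
  { apply HT with e; [exact (HT _ _ Hr Her)|]. apply He; auto. }
  split; apply HT with b; auto; apply Hb; auto.
Qed.

Definition least_transitive y T : Prop :=
  y ∈ T /\ (forall u, u ∈ T -> forall v, v ∈ u -> v ∈ T) /\
  forall T', M T' -> (forall u, u ∈ T' -> forall v, v ∈ u -> v ∈ T') ->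
    y ∈ T' -> forall u, u ∈ T -> u ∈ T'.

Lemma least_transitive_exists y T : M y -> M T -> trans T -> y ∈ T ->
  exists T0, M T0 /\ least_transitive y T0.
Proof.
  intros My MT HT Hy.
  destruct (separation (R := fun z => forall T', M T' ->
    (forall u, u ∈ T' -> forall v, v ∈ u -> v ∈ T') -> y ∈ T' -> z ∈ T')
    (a := T)) as (T0 & MT0 & H0); [dfn_tac|exact MT|].
  exists T0; split; [exact MT0|]. split; [|split].
  - apply H0; auto.
  - intros u Hu v Hv. apply H0 in Hu. apply H0. split.
    + exact (HT _ _ (proj1 Hu) Hv).
    + intros T' MT' HT' Hy'. apply (HT' u); [|exact Hv]. now apply Hu.
  - intros T' MT' HT' Hy' u Hu. apply H0 in Hu. now apply Hu.
Qed.

(** Least transitive sets are used because replacement, unlike collection,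
    needs a unique value.  The induction takes place outside of [M], which
    avoids a recursion of length omega inside of [M]. *)
Lemma transitive_closure x : M x -> exists T, M T /\ trans T /\ x ∈ T.
Proof.
  induction (mem_wf x) as [x _ IH]. intros Mx.
  assert (Ex : forall y, y ∈ x -> exists T, M T /\ least_transitive y T).
  { intros y Hy. assert (My := in_M Mx Hy).
    destruct (IH y Hy My) as (T & MT & HT & HyT).
    exact (least_transitive_exists My MT HT HyT). }
  assert (D : dfn M (fun rho => least_transitive (rho 1) (rho 0)))
    by (unfold least_transitive; dfn_tac).
  destruct (replacement D Mx Ex) as (B & MB & HB).
  - intros y T T' Hy MT MT' (H1 & H2 & H3) (H1' & H2' & H3').
    apply mem_ext. intros z; split; [apply H3|apply H3']; auto.
  - destruct (union MB) as (U & MU & HU).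
    destruct (pairing Mx Mx) as (sx & Msx & Hsx).
    destruct (union2 MU Msx) as (T & MT & HT).
    exists T; split; [exact MT|]. split.
    + intros u v Hu Hv. apply HT. left. apply HU. apply HT in Hu.
      destruct Hu as [Hu|Hu].
      * apply HU in Hu. destruct Hu as (C & HC & Hu).
        exists C; split; [exact HC|].
        apply HB in HC. destruct HC as (_ & y & _ & _ & K & _). now apply (K u).
      * assert (Hvx : v ∈ x) by (apply Hsx in Hu; destruct Hu as [->| ->]; exact Hv).
        destruct (Ex v Hvx) as (C & MC & HC). exists C. split; [|exact (proj1 HC)].
        apply HB. eauto.
    + apply HT. right. apply Hsx. auto.
Qed.

(** * Recursion on ternary relations *)

Ltac dfn_known ::=
  first [ apply dfn_opair | apply dfn_rel ].

Definition rel3 W p s x : Prop :=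
  exists g, M g /\ is_opair g s x /\ rel W p g.

Lemma dfn_rel3 : def4 M rel3.
Proof. intros W p s x HW Hp Hs Hx. unfold rel3. dfn_tac. Qed.

Ltac dfn_known ::=
  first [ apply dfn_opair | apply dfn_rel | apply dfn_rel3 ].

Lemma rel3_M W p s x : M W -> rel3 W p s x -> M p /\ M s /\ M x.
Proof.
  intros MW (g & Mg & Hg & Hr).
  split; [exact (proj1 (rel_M MW Hr))|exact (opair_M Hg Mg)].
Qed.

Lemma rel3_restriction (K : V -> V -> V -> Prop) T : def3 M K -> M T ->
  exists W, M W /\ forall p s x,
    rel3 W p s x <-> p ∈ T /\ s ∈ T /\ x ∈ T /\ K p s x.
Proof.
  intros DK MT.
  destruct (pairs_bound MT) as (Q & MQ & HQ).
  destruct (union2 MQ MT) as (T' & MT' & HT').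
  destruct (pairs_bound MT') as (Q' & MQ' & HQ').
  destruct (separation (R := fun e => exists p, p ∈ T /\ exists s, s ∈ T /\
    exists x, x ∈ T /\ K p s x /\ exists g, M g /\ is_opair g s x /\
    is_opair e p g) (a := Q')) as (W & MW & HW);
    [dfn_tac; apply DK; dfn_tac|exact MQ'|].
  exists W; split; [exact MW|]. intros p s x. split.
  - intros (g & Mg & Hg & e & He & HeW). apply HW in HeW.
    destruct HeW as (_ & p1 & Hp & s1 & Hs & x1 & Hx & HK & g1 & _ & Hg1 & He1).
    destruct (opair_inj He He1) as [-> ->].
    destruct (opair_inj Hg Hg1) as [-> ->]. auto.
  - intros (Hp & Hs & Hx & HK).
    destruct (opair_exists (in_M MT Hs) (in_M MT Hx)) as (g & Mg & Hg).
    destruct (opair_exists (in_M MT Hp) Mg) as (e & Me & He).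
    exists g; split; [exact Mg|]; split; [exact Hg|]. exists e; split; [exact He|].
    apply HW. split.
    + apply (HQ' _ _ _ He); apply HT'; [auto|]. left. exact (HQ _ _ _ Hg Hs Hx).
    + exists p; split; [exact Hp|]. exists s; split; [exact Hs|].
      exists x; split; [exact Hx|]. eauto.
Qed.

Section GreatestFixpoint.
Variables (Psi : (V -> V -> V -> Prop) -> V -> V -> V -> Prop) (Z : V).
Hypotheses (MZ : M Z)
  (Psi_mono : forall K K' : V -> V -> V -> Prop,
    (forall p s x, K p s x -> K' p s x) ->
    forall p s x, Psi K p s x -> Psi K' p s x)
  (Psi_local : forall T K p s x, M T -> trans T -> Z ∈ T ->
    p ∈ T -> s ∈ T -> x ∈ T -> Psi K p s x ->
    Psi (fun p s x => p ∈ T /\ s ∈ T /\ x ∈ T /\ K p s x) p s x)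
  (Psi_def : forall K : V -> V -> V -> V -> Prop,
    def4 M K -> def4 M (fun w => Psi (K w))).

(** The relation that satisfies the recursion clause [Psi], as a class of [M].
    By well-foundedness the recursions treated here have just one solution;
    taking the greatest one, approximated by sets of [M], gives a formula for
    it without having to construct approximations along an ordinal. *)
Definition gfp p s x : Prop :=
  exists W, M W /\ rel3 W p s x /\
    forall p, M p -> forall s, M s -> forall x, M x ->
      rel3 W p s x -> Psi (rel3 W) p s x.

Lemma gfp_M p s x : gfp p s x -> M p /\ M s /\ M x.
Proof. intros (W & MW & H & _). exact (rel3_M MW H). Qed.

Lemma gfp_unfold p s x : gfp p s x -> Psi gfp p s x.
Proof.
  intros (W & MW & H & HW). destruct (rel3_M MW H) as (Mp & Ms & Mx).
  apply Psi_mono with (rel3 W); [|auto]. intros p' s' x' H'. exists W; auto.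
Qed.

Lemma dfn_gfp : def3 M gfp.
Proof.
  intros p s x Hp Hs Hx. unfold gfp.
  dfn_tac.
  apply (Psi_def dfn_rel3); dfn_tac.
Qed.

(** The restriction of [Psi gfp] to a transitive set that contains [p], [s] and [x]
    is a set; by locality it is closed under [Psi], as [gfp] implies [Psi gfp]. *)
Lemma gfp_fold p s x : M p -> M s -> M x -> Psi gfp p s x -> gfp p s x.
Proof.
  intros Mp Ms Mx H.
  destruct (pairing Mp Ms) as (u & Mu & Hu).
  destruct (pairing Mx MZ) as (v & Mv & Hv).
  destruct (pairing Mu Mv) as (w & Mw & Hw).
  destruct (transitive_closure Mw) as (T & MT & HT & HwT).
  assert (HuT : u ∈ T) by (apply (HT w); [exact HwT|apply Hw; auto]).
  assert (HvT : v ∈ T) by (apply (HT w); [exact HwT|apply Hw; auto]).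
  assert (HpT : p ∈ T) by (apply (HT u); [exact HuT|apply Hu; auto]).
  assert (HsT : s ∈ T) by (apply (HT u); [exact HuT|apply Hu; auto]).
  assert (HxT : x ∈ T) by (apply (HT v); [exact HvT|apply Hv; auto]).
  assert (HZT : Z ∈ T) by (apply (HT v); [exact HvT|apply Hv; auto]).
  assert (D : def3 M (Psi gfp)).
  { intros a b c Ha Hb Hc.
    apply (Psi_def (K := fun _ => gfp)) with (w := a); auto.
    intros ? ? ? ? _. apply dfn_gfp. }
  destruct (rel3_restriction D MT) as (W & MW & HW).
  exists W; split; [exact MW|]. split; [apply HW; auto|].
  intros p' Mp' s' Ms' x' Mx' H'. apply HW in H'.
  destruct H' as (Hp' & Hs' & Hx' & H').
  apply Psi_mono with (2 := Psi_local MT HT HZT Hp' Hs' Hx' H').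
  intros p2 s2 x2 (Hp2 & Hs2 & Hx2 & H2). apply HW.
  repeat split; auto. now apply gfp_unfold.
Qed.

End GreatestFixpoint.

(** * Ordinals *)

Lemma mem_irrefl x : ~ x ∈ x.
Proof. induction (mem_wf x) as [x _ IH]. intros H. exact (IH x H H). Qed.

Lemma mem_asym x : forall y, x ∈ y -> ~ y ∈ x.
Proof.
  induction (mem_wf x) as [x _ IH]. intros y Hxy Hyx. exact (IH y Hyx x Hyx Hxy).
Qed.

Lemma mem_no_cycle x : forall y z, x ∈ y -> y ∈ z -> ~ z ∈ x.
Proof.
  induction (mem_wf x) as [x _ IH]. intros y z Hxy Hyz Hzx.
  exact (IH z Hzx x y Hzx Hxy Hyz).
Qed.

Lemma ordinal_mem a x : ordinal a -> x ∈ a -> ordinal x.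
Proof.
  intros [Ht Hl] Hx. split.
  - intros y z Hy Hz. assert (Hya := Ht _ _ Hx Hy).
    assert (Hza := Ht _ _ Hya Hz).
    destruct (Hl z x Hza Hx) as [H|[->|H]]; [exact H| |].
    + destruct (mem_asym Hy Hz).
    + destruct (mem_no_cycle H Hz Hy).
  - intros y z Hy Hz. apply Hl; eauto.
Qed.

Lemma ordinal_total a : forall b, ordinal a -> ordinal b ->
  a ∈ b \/ a = b \/ b ∈ a.
Proof.
  induction (mem_wf a) as [a _ IHa]. intros b.
  induction (mem_wf b) as [b _ IHb]. intros Oa Ob.
  apply NNPP. intros N. apply N. right; left. apply mem_ext. intros z.
  split; intros Hz.
  - destruct (IHa z Hz b (ordinal_mem Oa Hz) Ob) as [H|[->|H]]; [exact H| |].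
    + destruct N. auto.
    + destruct N. right; right. exact (proj1 Oa _ _ Hz H).
  - destruct (IHb z Hz Oa (ordinal_mem Ob Hz)) as [H|[->|H]]; [| |exact H].
    + destruct N. left. exact (proj1 Ob _ _ Hz H).
    + destruct N. auto.
Qed.

Lemma dfn_ordinal (a : (nat -> V) -> V) : tm M a -> dfn M (fun rho => ordinal (a rho)).
Proof.
  intros Ha.
  apply (dfn_ext (R := fun rho =>
    (forall x, x ∈ a rho -> forall y, y ∈ x -> y ∈ a rho) /\
    (forall x, x ∈ a rho -> forall y, y ∈ a rho -> x ∈ y \/ x = y \/ y ∈ x)));
    [|dfn_tac].
  intros rho _. unfold ordinal. split; intros [H1 H2]; split; eauto.
Qed.

Ltac dfn_known ::=
  first [ apply dfn_opair | apply dfn_rel | apply dfn_rel3 | apply dfn_ordinal ].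

(** This is the paradox of Burali-Forti, inside of [M]. *)
Lemma ordinal_outside C : M C -> exists b, M b /\ ordinal b /\ ~ b ∈ C.
Proof.
  intros MC. apply NNPP. intros N.
  assert (All : forall b, M b -> ordinal b -> b ∈ C).
  { intros b Mb Ob. apply NNPP. intros K. apply N. eauto. }
  destruct (separation (R := @ordinal V) (a := C)) as (O & MO & HO);
    [dfn_tac|exact MC|].
  assert (OO : ordinal O).
  { split.
    - intros x y Hx Hy. apply HO. assert (Mx := in_M MO Hx).
      apply HO in Hx. assert (Oy := ordinal_mem (proj2 Hx) Hy).
      split; [|exact Oy]. apply All; [exact (in_M Mx Hy)|exact Oy].
    - intros x y Hx Hy. apply HO in Hx, Hy. apply ordinal_total; tauto. }
  apply (@mem_irrefl O). apply HO. auto.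
Qed.

Lemma ordinal_subset_in_M a C : ordinal a -> M C ->
  (forall x, x ∈ a -> x ∈ C) -> M a.
Proof.
  intros Oa MC H. destruct (ordinal_outside MC) as (b & Mb & Ob & Hb).
  destruct (ordinal_total Oa Ob) as [K|[->|K]].
  - exact (in_M Mb K).
  - exact Mb.
  - destruct (Hb (H b K)).
Qed.

(** * The forcing relation *)

Section Forcing.
Variables (P le : V).
Hypotheses (MP : M P) (Mle : M le) (le_quasi : quasi_order (elem P) (rel le)).

Local Notation "p ≼ q" := (rel le p q) (at level 70, no associativity).

Lemma le_refl p : p ∈ P -> p ≼ p.
Proof. apply le_quasi. Qed.

Lemma le_trans p q r : p ∈ P -> q ∈ P -> r ∈ P -> p ≼ q -> q ≼ r -> p ≼ r.
Proof. apply le_quasi. Qed.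

(** The clauses by which [p] forces the name [s] to have the value [x]. *)
Definition forces_step (K : V -> V -> V -> Prop) p s x : Prop :=
  (forall s', M s' -> forall p', p' ∈ P -> rel s s' p' ->
     forall q, q ∈ P -> q ≼ p -> q ≼ p' ->
     exists r, r ∈ P /\ r ≼ q /\ exists x', x' ∈ x /\ K r s' x') /\
  (forall x', x' ∈ x -> forall q, q ∈ P -> q ≼ p ->
     exists r, r ∈ P /\ r ≼ q /\
       exists s', M s' /\ exists p', p' ∈ P /\ rel s s' p' /\ r ≼ p' /\ K r s' x').

(** As only values in [M] are of interest, the usual simultaneous recursion for
    equality and membership of names is replaced by this recursion on [x]. *)
Definition forces : V -> V -> V -> Prop := gfp forces_step.

Lemma forces_step_mono (K K' : V -> V -> V -> Prop) :
  (forall p s x, K p s x -> K' p s x) ->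
  forall p s x, forces_step K p s x -> forces_step K' p s x.
Proof.
  intros HK p s x (H1 & H2). split.
  - intros s' Ms' p' Hp' Hr q Hq Hqp Hqp'.
    destruct (H1 s' Ms' p' Hp' Hr q Hq Hqp Hqp') as (r & Hr' & Hrq & x' & Hx' & H).
    exists r; split; [exact Hr'|]; split; [exact Hrq|]. exists x'; auto.
  - intros x' Hx' q Hq Hqp.
    destruct (H2 x' Hx' q Hq Hqp)
      as (r & Hr & Hrq & s' & Ms' & p' & Hp' & Hs' & Hrp' & H).
    exists r; split; [exact Hr|]; split; [exact Hrq|].
    exists s'; split; [exact Ms'|]. exists p'; auto.
Qed.

Lemma forces_step_local T K p s x : M T -> trans T -> P ∈ T ->
  p ∈ T -> s ∈ T -> x ∈ T -> forces_step K p s x ->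
  forces_step (fun p s x => p ∈ T /\ s ∈ T /\ x ∈ T /\ K p s x) p s x.
Proof.
  intros MT HT HP Hp Hs Hx (H1 & H2). split.
  - intros s' Ms' p' Hp' Hr q Hq Hqp Hqp'.
    destruct (H1 s' Ms' p' Hp' Hr q Hq Hqp Hqp') as (r & Hr' & Hrq & x' & Hx' & H).
    exists r; split; [exact Hr'|]; split; [exact Hrq|]. exists x'.
    split; [exact Hx'|]. split; [exact (HT _ _ HP Hr')|].
    split; [exact (proj1 (rel_trans HT Hs Hr))|].
    split; [exact (HT _ _ Hx Hx')|exact H].
  - intros x' Hx' q Hq Hqp.
    destruct (H2 x' Hx' q Hq Hqp)
      as (r & Hr & Hrq & s' & Ms' & p' & Hp' & Hs' & Hrp' & H).
    exists r; split; [exact Hr|]; split; [exact Hrq|].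
    exists s'; split; [exact Ms'|]. exists p'.
    split; [exact Hp'|]; split; [exact Hs'|]; split; [exact Hrp'|].
    split; [exact (HT _ _ HP Hr)|].
    split; [exact (proj1 (rel_trans HT Hs Hs'))|].
    split; [exact (HT _ _ Hx Hx')|exact H].
Qed.

Lemma dfn_forces_step (K : V -> V -> V -> V -> Prop) :
  def4 M K -> def4 M (fun w => forces_step (K w)).
Proof.
  intros DK w p s x Hw Hp Hs Hx. unfold forces_step.
  dfn_tac; apply DK; dfn_tac.
Qed.

Lemma forces_unfold p s x : forces p s x -> forces_step forces p s x.
Proof. apply gfp_unfold, forces_step_mono. Qed.

Lemma forces_fold p s x : p ∈ P -> M s -> M x ->
  forces_step forces p s x -> forces p s x.
Proof.
  intros Hp. apply (gfp_fold MP forces_step_mono forces_step_local dfn_forces_step).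
  exact (in_M MP Hp).
Qed.

Lemma dfn_forces : def3 M forces.
Proof. exact (dfn_gfp dfn_forces_step). Qed.

Ltac dfn_known ::=
  first [ apply dfn_opair | apply dfn_rel | apply dfn_forces ].

Lemma forces_M p s x : forces p s x -> M s /\ M x.
Proof. intros H. apply (gfp_M H). Qed.

Lemma forces_mono p q s x : p ∈ P -> q ∈ P -> q ≼ p ->
  forces p s x -> forces q s x.
Proof.
  intros Hp Hq Hqp H. destruct (forces_M H) as [Ms Mx].
  apply forces_fold; auto. apply forces_unfold in H. destruct H as (H1 & H2).
  split.
  - intros s' Ms' p' Hp' Hs' r Hr Hrq. apply (H1 s' Ms' p' Hp' Hs' r Hr).
    exact (le_trans Hr Hq Hp Hrq Hqp).
  - intros x' Hx' r Hr Hrq. apply (H2 x' Hx' r Hr).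
    exact (le_trans Hr Hq Hp Hrq Hqp).
Qed.

Lemma forces_subset p s x x' : p ∈ P -> forces p s x -> forces p s x' ->
  forall y, y ∈ x ->
    (exists r s' y', r ∈ P /\ y' ∈ x' /\ forces r s' y /\ forces r s' y').
Proof.
  intros Hp H H' y Hy. apply forces_unfold in H, H'.
  destruct H as (_ & H2). destruct H' as (H1' & _).
  destruct (H2 y Hy p Hp (le_refl Hp))
    as (r & Hr & Hrp & s' & Ms' & p' & Hp' & Hs' & Hrp' & K).
  destruct (H1' s' Ms' p' Hp' Hs' r Hr Hrp Hrp')
    as (r' & Hr' & Hrr' & y' & Hy' & K').
  exists r', s', y'. eauto using forces_mono.
Qed.

(** A condition of [M] need not belong to a generic filter, so the two values are
    compared through the clauses of [forces_step], by induction. *)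
Lemma forces_unique x : forall p s x', p ∈ P ->
  forces p s x -> forces p s x' -> x = x'.
Proof.
  induction (mem_wf x) as [x _ IH]. intros p s x' Hp H H'.
  apply mem_ext. intros y. split; intros Hy.
  - destruct (forces_subset Hp H H' Hy) as (r & s' & y' & Hr & Hy' & K & K').
    now rewrite (IH y Hy r s' y' Hr K K').
  - destruct (forces_subset Hp H' H Hy) as (r & s' & y' & Hr & Hy' & K & K').
    now rewrite <- (IH y' Hy' r s' y Hr K' K).
Qed.

(** [p] forces the element [x] of [M] to belong to the value of [t]. *)
Definition forces_mem p t x : Prop :=
  forall q, q ∈ P -> q ≼ p ->
    exists r, r ∈ P /\ r ≼ q /\
      exists s, M s /\ exists p', p' ∈ P /\ rel t s p' /\ r ≼ p' /\ forces r s x.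

Definition forces_notin p t x : Prop :=
  forall q, q ∈ P -> q ≼ p -> ~ forces_mem q t x.

Lemma dfn_forces_mem : def3 M forces_mem.
Proof.
  intros p t x Hp Ht Hx. unfold forces_mem. dfn_tac.
Qed.

Ltac dfn_known ::=
  first [ apply dfn_opair | apply dfn_rel | apply dfn_forces
        | apply dfn_forces_mem ].

Lemma dfn_forces_notin : def3 M forces_notin.
Proof.
  intros p t x Hp Ht Hx. unfold forces_notin.
  dfn_tac.
Qed.

Lemma forces_mem_mono p q t x : p ∈ P -> q ∈ P -> q ≼ p ->
  forces_mem p t x -> forces_mem q t x.
Proof. intros Hp Hq Hqp H r Hr Hrq. eauto using le_trans. Qed.

Lemma forces_notin_mono p q t x : p ∈ P -> q ∈ P -> q ≼ p ->
  forces_notin p t x -> forces_notin q t x.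
Proof. intros Hp Hq Hqp H r Hr Hrq. apply H; eauto using le_trans. Qed.

Lemma forces_mem_local p t x : p ∈ P ->
  (forall q, q ∈ P -> q ≼ p -> exists r, r ∈ P /\ r ≼ q /\ forces_mem r t x) ->
  forces_mem p t x.
Proof.
  intros Hp H q Hq Hqp. destruct (H q Hq Hqp) as (r & Hr & Hrq & K).
  destruct (K r Hr (le_refl Hr)) as (r' & Hr' & Hrr' & K').
  exists r'; split; [exact Hr'|]; split; [|exact K'].
  exact (le_trans Hr' Hr Hq Hrr' Hrq).
Qed.

Lemma forces_notin_local p t x : p ∈ P ->
  (forall q, q ∈ P -> q ≼ p -> exists r, r ∈ P /\ r ≼ q /\ forces_notin r t x) ->
  forces_notin p t x.
Proof.
  intros Hp H q Hq Hqp K. destruct (H q Hq Hqp) as (r & Hr & Hrq & Kr).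
  apply (Kr r Hr (le_refl Hr)). exact (forces_mem_mono Hq Hr Hrq K).
Qed.

Lemma forces_mem_decided p t x : p ∈ P ->
  exists q, q ∈ P /\ q ≼ p /\ (forces_mem q t x \/ forces_notin q t x).
Proof.
  intros Hp. destruct (classic (forces_notin p t x)) as [H|H].
  - exists p. auto using le_refl.
  - apply NNPP. intros N. apply H. intros q Hq Hqp K. apply N. eauto.
Qed.

(** * Generic filters *)

Section Generic.
Variable G : V -> Prop.
Hypothesis G_generic : generic_filter M P (rel le) G.

Lemma G_sub p : G p -> p ∈ P.
Proof. apply G_generic. Qed.

Lemma G_up p q : G p -> q ∈ P -> p ≼ q -> G q.
Proof. apply G_generic. Qed.

Lemma G_down p q : G p -> G q -> exists r, G r /\ r ≼ p /\ r ≼ q.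
Proof. apply G_generic. Qed.

Lemma G_meets (D : V -> Prop) : dfn M (fun rho => D (rho 0)) ->
  (forall p, p ∈ P -> exists q, q ∈ P /\ q ≼ p /\ D q) ->
  exists p, G p /\ D p.
Proof.
  intros DD H. destruct (separation DD MP) as (d & Md & Hd).
  destruct (proj2 G_generic d Md) as (p & Gp & Hp).
  - intros p Hp. now apply Hd.
  - intros p Hp. destruct (H p Hp) as (q & Hq & Hqp & Dq).
    exists q. split; [apply Hd; auto|exact Hqp].
  - exists p. split; [exact Gp|]. now apply Hd.
Qed.

Lemma G_meets_below (D : V -> Prop) p : dfn M (fun rho => D (rho 0)) -> G p ->
  (forall q, q ∈ P -> q ≼ p -> exists r, r ∈ P /\ r ≼ q /\ D r) ->
  exists q, G q /\ D q.
Proof.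
  intros DD Gp H.
  destruct (G_meets (D := fun q => D q \/ forall r, r ∈ P -> r ≼ q -> ~ D r))
    as (q & Gq & Hq).
  - dfn_tac.
  - intros q Hq.
    destruct (classic (exists r, r ∈ P /\ r ≼ q /\ D r)) as [(r & K)|N].
    + exists r. tauto.
    + exists q. split; [exact Hq|]; split; [exact (le_refl Hq)|]. right.
      intros r Hr Hrq Dr. apply N. eauto.
  - destruct Hq as [Dq|N]; [eauto|]. exfalso.
    destruct (G_down Gp Gq) as (s & Gs & Hsp & Hsq).
    destruct (H s (G_sub Gs) Hsp) as (r & Hr & Hrs & Dr).
    apply (N r Hr); [|exact Dr]. 
    exact (le_trans Hr (G_sub Gs) (G_sub Gq) Hrs Hsq).
Qed.

Lemma forces_value x : forall p s, G p -> forces p s x -> value G s x.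
Proof.
  induction (mem_wf x) as [x _ IH]. intros p s Gp H.
  assert (Mx := proj2 (forces_M H)). assert (Ms := proj1 (forces_M H)).
  apply forces_unfold in H. destruct H as (H1 & H2).
  constructor.
  - intros s' p' Hs' Gp'. assert (Ms' := proj1 (rel_M Ms Hs')).
    destruct (G_down Gp Gp') as (q & Gq & Hqp & Hqp').
    destruct (G_meets_below (D := fun r => exists x', x' ∈ x /\ forces r s' x')
      (p := q)) as (r & Gr & x' & Hx' & K).
    + dfn_tac.
    + exact Gq.
    + intros q' Hq' Hqq'. apply (H1 s' Ms' p' (G_sub Gp') Hs' q' Hq');
        eauto using le_trans, G_sub.
    + exists x'. eauto.
  - intros x' Hx'. assert (Mx' := in_M Mx Hx').
    destruct (G_meets_below (D := fun r => exists s', M s' /\ exists p',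
      p' ∈ P /\ rel s s' p' /\ r ≼ p' /\ forces r s' x') (p := p))
      as (r & Gr & s' & Ms' & p' & Hp' & Hs' & Hrp' & K).
    + dfn_tac.
    + exact Gp.
    + exact (H2 x' Hx').
    + exists s', p'. split; [exact Hs'|]. split; [exact (G_up Gr Hp' Hrp')|].
      exact (IH x' Hx' r s' Gr K).
Qed.

(** Each of the two clauses of [forces_step] can only fail through a condition
    below which its failure is permanent; conditions of these kinds, together with
    those that force [x], are dense, and the permanent failures contradict the
    value of [s]. *)
Lemma value_forces x : forall s, M s -> M x -> value G s x ->
  exists p, G p /\ forces p s x.
Proof.
  induction (mem_wf x) as [x _ IH]. intros s Ms Mx H.
  destruct (G_meets (D := fun p => forces p s x \/
    (exists s', M s' /\ exists p', p' ∈ P /\ rel s s' p' /\ p ≼ p' /\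
       forall x', x' ∈ x -> forall r, r ∈ P -> r ≼ p -> ~ forces r s' x') \/
    (exists x', x' ∈ x /\ forall r, r ∈ P -> r ≼ p ->
       forall s', M s' -> forall p', p' ∈ P -> rel s s' p' -> r ≼ p' ->
       ~ forces r s' x'))) as (p & Gp & Hp).
  - dfn_tac.
  - intros p Hp. apply NNPP. intros N.
    apply N. exists p. split; [exact Hp|]; split; [exact (le_refl Hp)|]. left.
    apply forces_fold; auto. split.
    + intros s' Ms' p' Hp' Hs' q Hq Hqp Hqp'. apply NNPP. intros N'.
      apply N. exists q. split; [exact Hq|]; split; [exact Hqp|]. right; left.
      exists s'; split; [exact Ms'|]. exists p'.
      repeat (split; [assumption|]). intros x' Hx' r Hr Hrq K. apply N'. eauto 7.
    + intros x' Hx' q Hq Hqp. apply NNPP. intros N'.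
      apply N. exists q. split; [exact Hq|]; split; [exact Hqp|]. right; right.
      exists x'; split; [exact Hx'|]. intros r Hr Hrq s' Ms' p' Hp' Hs' Hrp' K.
      apply N'. eauto 12.
  - destruct H as [s x Hv1 Hv2].
    destruct Hp as [Hp|[(s' & Ms' & p' & Hp' & Hs' & Hpp' & N)|(x' & Hx' & N)]].
    + eauto.
    + exfalso. destruct (Hv1 s' p' Hs' (G_up Gp Hp' Hpp')) as (y & Hy & Hv).
      destruct (IH y Hy s' Ms' (in_M Mx Hy) Hv) as (p2 & Gp2 & K).
      destruct (G_down Gp Gp2) as (r & Gr & Hrp & Hrp2).
      apply (N y Hy r (G_sub Gr) Hrp). eauto using forces_mono, G_sub.
    + exfalso. destruct (Hv2 x' Hx') as (s' & p' & Hs' & Gp' & Hv).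
      assert (Ms' := proj1 (rel_M Ms Hs')).
      destruct (IH x' Hx' s' Ms' (in_M Mx Hx') Hv) as (p2 & Gp2 & K).
      destruct (G_down Gp Gp2) as (q & Gq & Hqp & Hqp2).
      destruct (G_down Gq Gp') as (r & Gr & Hrq & Hrp').
      assert (Hr := G_sub Gr). assert (Hq := G_sub Gq).
      apply (N r Hr (le_trans Hr Hq (G_sub Gp) Hrq Hqp) s' Ms' p' (G_sub Gp') Hs'
        Hrp').
      apply (forces_mono Hq Hr Hrq). apply (forces_mono (G_sub Gp2) Hq Hqp2 K).
Qed.

Lemma value_unique x : forall t x', value G t x -> value G t x' -> x = x'.
Proof.
  induction (mem_wf x) as [x _ IH]. intros t x' H H'.
  destruct H as [t x H1 H2]. inversion H' as [t' x0 H1' H2' E1 E2]; subst.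
  apply mem_ext. intros y. split; intros Hy.
  - destruct (H2 y Hy) as (s & p & Hs & Gp & Hv).
    destruct (H1' s p Hs Gp) as (y' & Hy' & Hv').
    now rewrite (IH y Hy s y' Hv Hv').
  - destruct (H2' y Hy) as (s & p & Hs & Gp & Hv).
    destruct (H1 s p Hs Gp) as (y' & Hy' & Hv').
    now rewrite <- (IH y' Hy' s y Hv' Hv).
Qed.

Lemma forces_mem_value p t a x : M t -> M x -> value G t a -> G p ->
  forces_mem p t x -> x ∈ a.
Proof.
  intros Mt Mx Ha Gp H.
  destruct (G_meets_below (D := fun r => exists s, M s /\ exists p',
    p' ∈ P /\ rel t s p' /\ r ≼ p' /\ forces r s x) (p := p))
    as (r & Gr & s & Ms & p' & Hp' & Hs & Hrp' & K).
  - dfn_tac.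
  - exact Gp.
  - exact H.
  - destruct Ha as [t a H1 _].
    destruct (H1 s p' Hs (G_up Gr Hp' Hrp')) as (y & Hy & Hv).
    now rewrite (value_unique (forces_value Gr K) Hv).
Qed.

Lemma value_forces_mem t a x : M t -> M x -> value G t a -> x ∈ a ->
  exists p, G p /\ forces_mem p t x.
Proof.
  intros Mt Mx Ha Hx. destruct Ha as [t a _ H2].
  destruct (H2 x Hx) as (s & p' & Hs & Gp' & Hv).
  assert (Ms := proj1 (rel_M Mt Hs)).
  destruct (value_forces Ms Mx Hv) as (p & Gp & K).
  destruct (G_down Gp Gp') as (r & Gr & Hrp & Hrp').
  exists r; split; [exact Gr|]. intros q Hq Hqr.
  assert (Hr := G_sub Gr). exists q; split; [exact Hq|].
  split; [exact (le_refl Hq)|]. exists s; split; [exact Ms|].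
  exists p'; split; [exact (G_sub Gp')|]. split; [exact Hs|].
  split; [exact (le_trans Hq Hr (G_sub Gp') Hqr Hrp')|].
  apply (forces_mono Hr Hq Hqr). exact (forces_mono (G_sub Gp) Hr Hrp K).
Qed.

Lemma forces_notin_value p t a x : M t -> M x -> value G t a -> G p ->
  forces_notin p t x -> ~ x ∈ a.
Proof.
  intros Mt Mx Ha Gp H Hx.
  destruct (value_forces_mem Mt Mx Ha Hx) as (q & Gq & Kq).
  destruct (G_down Gp Gq) as (r & Gr & Hrp & Hrq).
  apply (H r (G_sub Gr) Hrp). exact (forces_mem_mono (G_sub Gq) (G_sub Gr) Hrq Kq).
Qed.

(** A set of [N] need not be covered by a set of [M]; but that part of it which
    consists of elements of [M] is, as each of them is forced to be the value of
    one of the names in [t], and such a name and a condition determine it. *)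
Lemma value_cover t a : M t -> value G t a ->
  exists B, M B /\ forall x, x ∈ a -> M x -> x ∈ B.
Proof.
  intros Mt Ha.
  destruct (transitive_closure Mt) as (T & MT & HT & HtT).
  destruct (union2 MT MP) as (T' & MT' & HT').
  destruct (pairs_bound MT') as (Q & MQ & HQ).
  set (R := fun e x => exists s, M s /\ exists p, p ∈ P /\ is_opair e s p /\
    forces p s x).
  assert (DR : def2 M R).
  { intros e x He Hx. unfold R. dfn_tac. }
  destruct (separation (R := fun e => exists x, M x /\ R e x) (a := Q))
    as (A & MA & HA); [dfn_tac; apply DR; dfn_tac|exact MQ|].
  destruct (replacement (R := R) (a := A)) as (B & MB & HB).
  - apply DR; dfn_tac.
  - exact MA.
  - intros e He. now apply HA in He.
  - intros e x x' _ _ _ (s & _ & p & Hp & He & K) (s' & _ & p' & Hp' & He' & K').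
    destruct (opair_inj He He') as [<- <-]. exact (forces_unique Hp K K').
  - exists B; split; [exact MB|]. intros x Hx Mx.
    destruct Ha as [t a _ H2].
    destruct (H2 x Hx) as (s & p' & Hs & Gp' & Hv).
    assert (Ms := proj1 (rel_M Mt Hs)).
    destruct (value_forces Ms Mx Hv) as (p & Gp & K).
    assert (Hp := G_sub Gp).
    destruct (opair_exists Ms (in_M MP Hp)) as (e & Me & He).
    assert (Re : R e x) by (exists s; split; [exact Ms|]; exists p; auto).
    apply HB. split; [exact Mx|]. exists e; split; [|exact Re].
    apply HA. split; [|eauto]. apply (HQ e s p He); apply HT'; [left|auto].
    exact (proj1 (rel_trans HT HtT Hs)).
Qed.

Lemma value_mem t a x : M t -> value G t a -> x ∈ a ->
  exists s, M s /\ value G s x.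
Proof.
  intros Mt Ha Hx. destruct Ha as [t a _ H2].
  destruct (H2 x Hx) as (s & p & Hs & _ & Hv).
  exists s. split; [exact (proj1 (rel_M Mt Hs))|exact Hv].
Qed.

(** By induction the elements of [x] are in [M], hence covered by a set of [M].
    That set misses some ordinal of [M], which is then not below [x]. *)
Lemma value_ordinal x : forall t, M t -> value G t x -> ordinal x -> M x.
Proof.
  induction (mem_wf x) as [x _ IH]. intros t Mt Hv Ox.
  destruct (value_cover Mt Hv) as (B & MB & HB).
  apply ordinal_subset_in_M with B; auto. intros y Hy. apply HB; [exact Hy|].
  destruct (value_mem Mt Hv Hy) as (s & Ms & Hs).
  exact (IH y Hy s Ms Hs (ordinal_mem Ox Hy)).
Qed.

(** * Canonical names *)

(** [c] is the canonical name of [x] all of whose pairs, hereditarily, have the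
    condition [p].  Fixing [p] makes the name unique, even if there is no
    weakest condition. *)
Definition check_step (K : V -> V -> V -> Prop) p c x : Prop :=
  (forall e, e ∈ c -> exists x', x' ∈ x /\ exists c', M c' /\
     is_opair e c' p /\ K p c' x') /\
  (forall x', x' ∈ x -> exists c', M c' /\ exists e, e ∈ c /\
     is_opair e c' p /\ K p c' x').

Definition check : V -> V -> V -> Prop := gfp check_step.

Lemma check_step_mono (K K' : V -> V -> V -> Prop) :
  (forall p s x, K p s x -> K' p s x) ->
  forall p s x, check_step K p s x -> check_step K' p s x.
Proof.
  intros HK p c x (H1 & H2). split.
  - intros e He. destruct (H1 e He) as (x' & Hx' & c' & Mc' & K1 & K2).
    exists x'; split; [exact Hx'|]. exists c'; auto.
  - intros x' Hx'. destruct (H2 x' Hx') as (c' & Mc' & e & He & K1 & K2).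
    exists c'; split; [exact Mc'|]. exists e; auto.
Qed.

Lemma check_step_local T K p c x : M T -> trans T -> P ∈ T ->
  p ∈ T -> c ∈ T -> x ∈ T -> check_step K p c x ->
  check_step (fun p c x => p ∈ T /\ c ∈ T /\ x ∈ T /\ K p c x) p c x.
Proof.
  intros MT HT HP Hp Hc Hx (H1 & H2).
  assert (Hc' : forall e c', e ∈ c -> is_opair e c' p -> c' ∈ T).
  { intros e c' He He'. apply (rel_trans HT Hc (x := c') (y := p)).
    exists e; auto. }
  split.
  - intros e He. destruct (H1 e He) as (x' & Hx' & c' & Mc' & K1 & K2).
    exists x'; split; [exact Hx'|]. exists c'.
    assert (x' ∈ T) by exact (HT _ _ Hx Hx'). eauto 8.
  - intros x' Hx'. destruct (H2 x' Hx') as (c' & Mc' & e & He & K1 & K2).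
    exists c'; split; [exact Mc'|]. exists e.
    assert (x' ∈ T) by exact (HT _ _ Hx Hx'). eauto 8.
Qed.

Lemma dfn_check_step (K : V -> V -> V -> V -> Prop) :
  def4 M K -> def4 M (fun w => check_step (K w)).
Proof.
  intros DK w p s x Hw Hp Hs Hx. unfold check_step.
  dfn_tac; apply DK; dfn_tac.
Qed.

Lemma dfn_check : def3 M check.
Proof. exact (dfn_gfp dfn_check_step). Qed.

Ltac dfn_known ::=
  first [ apply dfn_opair | apply dfn_rel | apply dfn_ordinal
        | apply dfn_check | apply dfn_forces_mem | apply dfn_forces_notin ].

Lemma check_unique x : forall p c c', check p c x -> check p c' x -> c = c'.
Proof.
  assert (Sub : forall p c c' x,
    (forall y, y ∈ x -> forall d d', check p d y -> check p d' y -> d = d') ->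
    check p c x -> check p c' x -> forall e, e ∈ c -> e ∈ c').
  { clear x. intros p c c' x IH H H' e He.
    apply gfp_unfold in H; [|exact check_step_mono].
    apply gfp_unfold in H'; [|exact check_step_mono].
    destruct (proj1 H e He) as (y & Hy & d & Md & Hd & K).
    destruct (proj2 H' y Hy) as (d' & Md' & e' & He' & Hd' & K').
    rewrite (IH y Hy d d' K K') in Hd. now rewrite (opair_unique Hd Hd'). }
  induction (mem_wf x) as [x _ IH]. intros p c c' H H'.
  apply mem_ext. intros e. split; eapply Sub; eauto.
Qed.

Lemma check_exists p x : M p -> M x -> exists c, check p c x.
Proof.
  intros Mp. induction (mem_wf x) as [x _ IH]. intros Mx.
  set (R := fun y e => exists c, M c /\ is_opair e c p /\ check p c y).
  destruct (replacement (R := R) (a := x)) as (b & Mb & Hb).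
  - unfold R. dfn_tac.
  - exact Mx.
  - intros y Hy. destruct (IH y Hy (in_M Mx Hy)) as (c & Hc).
    destruct (gfp_M Hc) as (_ & Mc & _).
    destruct (opair_exists Mc Mp) as (e & Me & He).
    exists e; split; [exact Me|]. exists c; auto.
  - intros y e e' _ _ _ (c & _ & He & Hc) (c' & _ & He' & Hc').
    rewrite (check_unique Hc Hc') in He. exact (opair_unique He He').
  - exists b.
    apply (gfp_fold MP check_step_mono check_step_local dfn_check_step); auto.
    split.
    + intros e He. apply Hb in He. destruct He as (Me & y & Hy & c & Hc).
      exists y; split; [exact Hy|]. exists c; exact Hc.
    + intros y Hy. destruct (IH y Hy (in_M Mx Hy)) as (c & Hc).
      destruct (gfp_M Hc) as (_ & Mc & _).
      destruct (opair_exists Mc Mp) as (e & Me & He).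
      exists c; split; [exact Mc|]. exists e; split; [|auto].
      apply Hb. split; [exact Me|]. exists y; split; [exact Hy|].
      exists c; auto.
Qed.

Lemma check_name x : forall p c, p ∈ P -> check p c x -> name P c.
Proof.
  induction (mem_wf x) as [x _ IH]. intros p c Hp H. constructor. intros e He.
  apply gfp_unfold in H; [|exact check_step_mono].
  destruct (proj1 H e He) as (y & Hy & d & Md & Hd & K).
  exists d, p. eauto.
Qed.

Lemma check_value x : forall p c, G p -> check p c x -> value G c x.
Proof.
  induction (mem_wf x) as [x _ IH]. intros p c Gp H.
  apply gfp_unfold in H; [|exact check_step_mono]. constructor.
  - intros s p' (e & He & Hec) _.
    destruct (proj1 H e Hec) as (y & Hy & d & Md & Hd & K).
    destruct (opair_inj He Hd) as [-> ->]. eauto.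
  - intros y Hy. destruct (proj2 H y Hy) as (d & Md & e & He & Hd & K).
    exists d, p. split; [exists e; auto|]. eauto.
Qed.

(** * Ramsey colorings and decisions in the generic filter *)

Section Ramsey.
Variables (Xs fine : V).
Hypotheses (MXs : M Xs) (Mfine : M fine)
  (EC : ec_poset (elem P) (elem Xs) (rel fine) (rel le))
  (LRA : left_right_axiom_in M P Xs (rel fine) (rel le))
  (ramsey : cubes_ramsey_in M P (rel fine)).

(** By separation the function on the cube of [x] with the values 0 and 1 that
    tells whether [D] holds is a set of [M], and so is one of the colorings which
    the Ramsey property covers. *)
Lemma ramsey_class (D : V -> Prop) x : dfn M (fun rho => D (rho 0)) -> x ∈ P ->
  exists y, cube (elem P) (rel fine) x y /\
    ((forall z, cube (elem P) (rel fine) y z -> D z) \/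
     (forall z, cube (elem P) (rel fine) y z -> ~ D z)).
Proof.
  intros DD Hx. assert (Mx := in_M MP Hx).
  destruct (separation (R := fun x => x <> x) (a := P)) as (zero & Mzero & Hzero);
    [dfn_tac|exact MP|].
  destruct (pairing Mzero Mzero) as (one & Mone & Hone).
  destruct (pairing Mzero Mone) as (two & Mtwo & Htwo).
  assert (Ntwo : natural two).
  { apply natural_succ with one.
    - apply natural_succ with zero.
      + apply natural_zero. intros z Hz. apply Hzero in Hz. tauto.
      + intros z. rewrite (Hone z), (Hzero z). tauto.
    - intros z. rewrite (Htwo z), (Hone z). tauto. }
  assert (N01 : one <> zero).
  { intros E. assert (K : zero ∈ one) by (apply Hone; auto).
    rewrite E in K. exact (mem_irrefl K). }
  set (c := fun y => if excluded_middle_informative (D y) then one else zero).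
  assert (Hc : forall y v, v = c y <-> (D y /\ v = one) \/ (~ D y /\ v = zero)).
  { intros y v. unfold c. destruct (excluded_middle_informative (D y)); tauto. }
  destruct (union2 MP Mtwo) as (T & MT & HT).
  destruct (pairs_bound MT) as (Q & MQ & HQ).
  assert (c_two : forall y, c y ∈ two).
  { intros y. apply Htwo. unfold c.
    destruct (excluded_middle_informative (D y)); auto. }
  destruct (separation (R := fun e => exists y, y ∈ P /\ rel fine y x /\
    exists v, v ∈ two /\ is_opair e y v /\
      ((D y /\ v = one) \/ (~ D y /\ v = zero))) (a := Q))
    as (C & MC & HC); [dfn_tac; apply (dfn_subst DD); dfn_tac|exact MQ|].
  assert (Graph : exists F, M F /\ is_graph (cube (elem P) (rel fine) x) c F).
  { exists C; split; [exact MC|]. split.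
    - intros e He. apply HC in He.
      destruct He as (_ & y & Hy & Hyx & v & Hv & He & K).
      apply Hc in K. subst v. exists y. split; [split; auto|exact He].
    - intros y [Hy Hyx].
      destruct (opair_exists (in_M MP Hy) (in_M Mtwo (c_two y))) as (e & Me & He).
      exists e; split; [exact He|]. apply HC. split.
      + apply (HQ _ _ _ He); apply HT; [left; exact Hy|right; apply c_two].
      + exists y; split; [exact Hy|]; split; [exact Hyx|].
        exists (c y); split; [apply c_two|]; split; [exact He|]. now apply Hc. }
  assert (inhabited : exists i, i ∈ two) by (exists zero; apply Htwo; auto).
  destruct (ramsey Hx Mtwo Ntwo inhabited (fun y _ => c_two y) Graph)
    as (y & Hy & Hom).
  exists y; split; [exact Hy|].
  assert (Hyy := cube_refl EC (proj1 Hy)).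
  destruct (classic (D y)) as [K|K]; [left|right]; intros z Hz;
    specialize (Hom y z Hyy Hz); unfold c in Hom;
    destruct (excluded_middle_informative (D y)), (excluded_middle_informative (D z));
    tauto || congruence.
Qed.

(** The coloring by [left_below_right] is a class of [M].  So the Ramsey property
    and the Left-Right Axiom yield densely many conditions that either decide all
    questions or exclude every answer to one of them; in [G] only the former
    occur. *)
Lemma generic_decides (A : Type) (I : V) (R : V -> V -> A -> Prop) : M I ->
  (forall i, i ∈ I -> ordinal i) ->
  (forall p q i v, p ∈ P -> q ∈ P -> q ≼ p -> R p i v -> R q i v) ->
  (forall p i v w, p ∈ P -> i ∈ I -> R p i v -> R p i w -> v = w) ->
  (forall p i v, p ∈ P ->
    (forall q, q ∈ P -> q ≼ p -> exists r, r ∈ P /\ r ≼ q /\ R r i v) -> R p i v) ->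
  def2 M (decides (elem P) (rel le) R) ->
  (forall i, i ∈ I -> exists p v, G p /\ R p i v) ->
  exists q, G q /\ forall i, i ∈ I -> exists v, R q i v.
Proof.
  intros MI OI R_mono R_unique R_local DR Answered.
  destruct LRA as (Left & Right & (L & ML & HL1 & HL2) & (Rt & MRt & HR1 & HR2) & LR).
  assert (L_rel : forall z l, z ∈ Xs -> (rel L z l <-> l = Left z)).
  { intros z l Hz. split.
    - intros (e & He & HeL). destruct (HL1 e HeL) as (z' & _ & He').
      destruct (opair_inj He He') as [-> ->]. reflexivity.
    - intros ->. exact (HL2 z Hz). }
  assert (R_rel : forall z l, z ∈ Xs -> (rel Rt z l <-> l = Right z)).
  { intros z l Hz. split.
    - intros (e & He & HeR). destruct (HR1 e HeR) as (z' & _ & He').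
      destruct (opair_inj He He') as [-> ->]. reflexivity.
    - intros ->. exact (HR2 z Hz). }
  assert (I_trans : forall i j k, elem I i -> elem I j -> elem I k ->
    i ∈ j -> j ∈ k -> i ∈ k).
  { intros i j k _ _ Hk Hij Hjk. exact (proj1 (OI k Hk) j i Hjk Hij). }
  assert (I_total : forall i j, elem I i -> elem I j -> i ∈ j \/ i = j \/ j ∈ i).
  { intros i j Hi Hj. apply ordinal_total; auto. }
  set (dec := decides (elem P) (rel le) R) in *.
  set (upto := fun r i => dec r i /\ forall j, j ∈ I -> j ∈ i -> dec r j).
  assert (Dupto : def2 M upto).
  { intros r i Hr Hi. unfold upto. dfn_tac; apply DR; dfn_tac. }
  set (color := fun z => forall l, M l -> rel L z l -> forall r, M r -> rel Rt z r ->
    forall i, i ∈ I -> upto l i -> upto r i).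
  assert (Dcolor : dfn M (fun rho => color (rho 0))).
  { unfold color. clearbody upto. dfn_tac; apply Dupto; dfn_tac. }
  assert (color_spec : forall z, z ∈ P -> (color z <->
    left_below_right (elem P) (rel le) Left Right (elem I) (@mem V) R z)).
  { intros z Hz. assert (Hz' : z ∈ Xs) by exact (ec_sub EC Hz). split.
    - intros K.
      exact (K _ (in_M MXs (lr_left LR Hz')) (proj2 (L_rel z _ Hz') eq_refl)
        _ (in_M MXs (lr_right LR Hz')) (proj2 (R_rel z _ Hz') eq_refl)).
    - intros K l _ Hl r _ Hr. apply L_rel in Hl; auto. apply R_rel in Hr; auto.
      subst l r. exact K. }
  (* The conditions that decide all questions are dense only below those that
     leave each of them decidable; the others exclude every answer to one of them. *)
  destruct (G_meets (D := fun q => (forall i, i ∈ I -> dec q i) \/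
    exists i, i ∈ I /\ forall r, r ∈ P -> r ≼ q -> ~ dec r i)) as (q & Gq & Hq).
  - dfn_tac; apply DR; dfn_tac.
  - intros p Hp.
    destruct (classic (exists q, q ∈ P /\ q ≼ p /\ exists i, i ∈ I /\
      forall r, r ∈ P -> r ≼ q -> ~ dec r i)) as [(q & Hq & Hqp & K)|N].
    { exists q; auto. }
    destruct (ramsey_class Dcolor Hp) as (q & [Hq Hqp] & Hom).
    exists q; split; [exact Hq|]. split; [exact (le_les EC Hq Hp Hqp)|]. left.
    destruct Hom as [Hom|Hom].
    + apply (homogeneous_decides EC LR (@mem_wf V) R_mono R_unique R_local Hp
        (conj Hq Hqp)).
      * intros i Hi r Hr Hrp. apply NNPP. intros N'. apply N.
        exists r; split; [exact Hr|]; split; [exact Hrp|].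
        exists i; split; [exact Hi|]. intros r' Hr' Hrr' K. apply N'.
        destruct (decides_elim EC Hr' K) as (v & Kv). exists r', v. auto.
      * intros z Hz. apply color_spec; [exact (proj1 Hz)|]. now apply Hom.
    + destruct (not_homogeneous_complement EC LR I_trans I_total
        (R := R) (q := q) Hq).
      intros z Hz K. apply (Hom z Hz). apply color_spec; [exact (proj1 Hz)|exact K].
  - exists q; split; [exact Gq|]. intros i Hi. assert (Hq' := G_sub Gq).
    destruct Hq as [K|(j & Hj & N)]; [exact (decides_elim EC Hq' (K i Hi))|].
    exfalso. destruct (Answered j Hj) as (p & v & Gp & Kp).
    destruct (G_down Gp Gq) as (r & Gr & Hrp & Hrq).
    apply (N r (G_sub Gr) Hrq).
    apply (decides_intro (v := v) R_mono (G_sub Gr)).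
    exact (R_mono p r j v (G_sub Gp) (G_sub Gr) Hrp Kp).
Qed.

(** The decisions of [q] single out the elements of [a] within a set of [M] that
    covers them. *)
Lemma decided_value_in_M t a q : M t -> value G t a -> G q ->
  (forall x, x ∈ a -> M x /\ forces_mem q t x) -> M a.
Proof.
  intros Mt Ha Gq H. assert (Mq := in_M MP (G_sub Gq)).
  destruct (value_cover Mt Ha) as (B & MB & HB).
  destruct (separation (R := fun x => forces_mem q t x) (a := B))
    as (b & Mb & Hb); [dfn_tac|exact MB|].
  replace a with b; [exact Mb|]. apply mem_ext. intros x. rewrite (Hb x). split.
  - intros (Hx & K). exact (forces_mem_value Mt (in_M MB Hx) Ha Gq K).
  - intros Hx. destruct (H x Hx). auto.
Qed.

Lemma set_of_ordinals_in_M t a : M t -> value G t a ->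
  (forall x, x ∈ a -> ordinal x) -> M a.
Proof.
  intros Mt Ha Oa.
  assert (aM : forall x, x ∈ a -> M x).
  { intros x Hx. destruct (value_mem Mt Ha Hx) as (s & Ms & Hs).
    exact (value_ordinal Ms Hs (Oa x Hx)). }
  destruct (value_cover Mt Ha) as (B & MB & HB).
  destruct (separation (R := @ordinal V) (a := B)) as (I & MI & HI);
    [dfn_tac|exact MB|].
  set (R := fun p i (v : bool) =>
    if v then forces_mem p t i else forces_notin p t i).
  destruct (generic_decides (R := R) MI) as (q & Gq & Hq).
  - intros i Hi. now apply HI in Hi.
  - intros p q i [|] Hp Hq Hqp; [apply forces_mem_mono|apply forces_notin_mono];
      assumption.
  - intros p i [|] [|] Hp _ H1 H2; try reflexivity; exfalso.
    + exact (H2 p Hp (le_refl Hp) H1).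
    + exact (H1 p Hp (le_refl Hp) H2).
  - intros p i [|] Hp; [apply forces_mem_local|apply forces_notin_local];
      assumption.
  - intros r i Hr Hi. unfold R.
    apply (dfn_ext (R := fun rho =>
      (forall q, q ∈ P -> q ≼ r rho -> forces_mem q t (i rho)) \/
      (forall q, q ∈ P -> q ≼ r rho -> forces_notin q t (i rho)))); [|dfn_tac].
    intros rho _. split.
    + intros [H|H]; [exists true|exists false]; exact H.
    + intros [[|] H]; [left|right]; exact H.
  - intros i Hi. assert (Mi := in_M MI Hi).
    destruct (G_meets (D := fun q => forces_mem q t i \/ forces_notin q t i))
      as (q & Gq & [K|K]).
    + dfn_tac.
    + intros p Hp. exact (forces_mem_decided t i Hp).
    + exists q, true. auto.
    + exists q, false. auto.
  - apply (decided_value_in_M Mt Ha Gq). intros x Hx.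
    assert (Mx := aM x Hx). split; [exact Mx|].
    destruct (Hq x) as ([|] & K).
    + apply HI. auto.
    + exact K.
    + destruct (forces_notin_value Mt Mx Ha Gq K Hx).
Qed.

Lemma sequence_in_M t f alpha (s : V -> V) : M t -> value G t f ->
  ordinal alpha -> (forall xi, xi ∈ alpha -> M (s xi)) ->
  is_graph (elem alpha) s f -> M f.
Proof.
  intros Mt Hf Oalpha Ms [Hf1 Hf2].
  assert (Mxi : forall xi, xi ∈ alpha -> M xi).
  { intros xi Hxi. destruct (Hf2 xi Hxi) as (e & (a & b & Ha & Hb & He) & Hef).
    destruct (value_mem Mt Hf Hef) as (t1 & Mt1 & H1).
    destruct (value_mem (x := a) Mt1 H1) as (t2 & Mt2 & H2); [apply He; auto|].
    destruct (value_mem (x := xi) Mt2 H2) as (t3 & Mt3 & H3); [apply Ha; auto|].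
    exact (value_ordinal Mt3 H3 (ordinal_mem Oalpha Hxi)). }
  assert (fM : forall e, e ∈ f -> M e).
  { intros e He. destruct (Hf1 e He) as (xi & Hxi & K).
    exact (opair_in_M K (Mxi xi Hxi) (Ms xi Hxi)). }
  destruct (value_cover Mt Hf) as (B & MB & HB).
  destruct (transitive_closure MB) as (C & MC & HC & HBC).
  assert (Malpha : M alpha).
  { apply (ordinal_subset_in_M Oalpha MC). intros xi Hxi.
    destruct (Hf2 xi Hxi) as (e & He & Hef).
    apply (rel_trans HC HBC (x := xi) (y := s xi)).
    exists e. split; [exact He|]. auto. }
  (* Not every condition forces [t] to be a function, so an answer [v] has to
     exclude all the others explicitly. *)
  set (R := fun p i v => M v /\ forall w, M w -> forall e, M e -> is_opair e i w ->
    (w = v -> forces_mem p t e) /\ (w <> v -> forces_notin p t e)).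
  destruct (generic_decides (R := R) Malpha) as (q & Gq & Hq).
  - intros i Hi. exact (ordinal_mem Oalpha Hi).
  - intros p q i v Hp Hq Hqp [Mv H]. split; [exact Mv|]. intros w Mw e Me He.
    destruct (H w Mw e Me He) as [H1 H2].
    split; intros K; [exact (forces_mem_mono Hp Hq Hqp (H1 K))|].
    exact (forces_notin_mono Hp Hq Hqp (H2 K)).
  - intros p i v v' Hp Hi [Mv H] [Mv' H']. apply NNPP. intros N.
    destruct (opair_exists (Mxi i Hi) Mv) as (e & Me & He).
    apply (proj2 (H' v Mv e Me He) N p Hp (le_refl Hp)).
    exact (proj1 (H v Mv e Me He) eq_refl).
  - intros p i v Hp H. split.
    + destruct (H p Hp (le_refl Hp)) as (r & _ & _ & Mv & _). exact Mv.
    + intros w Mw e Me He.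
      split; intros K; [apply (forces_mem_local Hp)|apply (forces_notin_local Hp)];
        intros q Hq Hqp; destruct (H q Hq Hqp) as (r & Hr & Hrq & _ & Kr);
        exists r; split; auto; split; auto; now apply (Kr w Mw e Me He).
  - intros r i Hr Hi. unfold R.
    apply (dfn_ext (R := fun rho => exists v, M v /\ forall q, q ∈ P ->
      q ≼ r rho -> forall w, M w -> forall e, M e -> is_opair e (i rho) w ->
      (w = v -> forces_mem q t e) /\ (w <> v -> forces_notin q t e))); [|dfn_tac].
    intros rho Hrho. split.
    + intros (v & Mv & H). exists v. intros q Hq Hqr. split; [exact Mv|auto].
    + intros (v & H).
      destruct (classic (exists q, q ∈ P /\ q ≼ r rho)) as [(q & Hq & Hqr)|N].
      * exists v. split; [apply (H q Hq Hqr)|]. intros q' Hq' Hqr'.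
        apply (H q' Hq' Hqr').
      (* Without a condition below, any element of [M] will do. *)
      * exists P. split; [exact MP|]. intros q Hq Hqr. destruct N. eauto.
  - intros i Hi. assert (Mi := Mxi i Hi). assert (Msi := Ms i Hi).
    destruct (Hf2 i Hi) as (e & He & Hef). assert (Me := fM e Hef).
    destruct (value_forces_mem Mt Me Hf Hef) as (p & Gp & Kp).
    destruct (G_meets_below (D := fun r =>
      (forall w, M w -> forall e, M e -> is_opair e i w ->
        (w = s i -> forces_mem r t e) /\ (w <> s i -> forces_notin r t e)) \/
      (exists w, M w /\ w <> s i /\ exists e', M e' /\ is_opair e' i w /\
        forces_mem r t e')) (p := p)) as (r & Gr & [K|K]).
    + set (si := s i) in *. clearbody si. dfn_tac.
    + exact Gp.
    + intros q Hq Hqp.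
      destruct (classic (exists r, r ∈ P /\ r ≼ q /\ exists w, M w /\ w <> s i /\
        exists e', M e' /\ is_opair e' i w /\ forces_mem r t e'))
        as [(r & Hr & Hrq & K)|N]; [exists r; auto|].
      exists q; split; [exact Hq|]; split; [exact (le_refl Hq)|]. left.
      intros w Mw e' Me' He'. split.
      * intros ->. rewrite (opair_unique He' He).
        exact (forces_mem_mono (G_sub Gp) Hq Hqp Kp).
      * intros Hw r Hr Hrq K. apply N. exists r; split; [exact Hr|].
        split; [exact Hrq|]. exists w; split; [exact Mw|]; split; [exact Hw|].
        exists e'; auto.
    + exists r, (s i). split; [exact Gr|]. split; [exact Msi|exact K].
    + exfalso. destruct K as (w & Mw & Hw & e' & Me' & He' & K).
      destruct (Hf1 e' (forces_mem_value Mt Me' Hf Gr K)) as (j & _ & He'').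
      destruct (opair_inj He' He'') as [<- ->]. now apply Hw.
  - apply (decided_value_in_M Mt Hf Gq). intros e He. split; [exact (fM e He)|].
    destruct (Hf1 e He) as (xi & Hxi & K).
    destruct (Hq xi Hxi) as (v & Mv & Kv).
    destruct (opair_exists (Mxi xi Hxi) Mv) as (e' & Me' & He').
    assert (F := proj1 (Kv v Mv e' Me' He') eq_refl).
    destruct (Hf1 e' (forces_mem_value Mt Me' Hf Gq F)) as (xi' & _ & He'').
    destruct (opair_inj He' He'') as [<- ->].
    now rewrite (opair_unique K He'').
Qed.

End Ramsey.

End Generic.
End Forcing.
End Model.

Theorem theorem1p3 (V : universe) (M N : V -> Prop) (X Xs le les : V)
    (M_transitive : transitive_class M) (M_ZF : models_ZF M)
    (X_in_M : M X) (Xs_in_M : M Xs) (le_in_M : M le) (les_in_M : M les)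
    (EC : ec_poset (elem X) (elem Xs) (rel le) (rel les))
    (LRA : left_right_axiom_in M X Xs (rel le) (rel les))
    (ramsey : cubes_ramsey_in M X (rel le))
    (N_generic : generic_extension M X (rel les) N) :
  (forall a : V, (forall x : V, x ∈ a -> ordinal x) -> (M a <-> N a)) /\
  (forall (alpha f : V) (s : V -> V), ordinal alpha ->
     (forall xi : V, xi ∈ alpha -> M (s xi)) ->
     is_graph (elem alpha) s f -> N f -> M f).
Proof.
  destruct N_generic as (G & G_generic & _ & HN).
  assert (les_quasi := cp_les (ec_coarsened EC)).
  split.
  - intros a Oa. split.
    + intros Ma. destruct (filter_nonempty (proj1 G_generic)) as (p & Gp).
      assert (Hp := filter_sub (proj1 G_generic) Gp).
      destruct (check_exists M_transitive M_ZF X_in_M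
        (M_transitive X p X_in_M Hp) Ma) as (c & Hc).
      apply HN. exists c. split; [exact (proj1 (proj2 (gfp_M M_transitive Hc)))|].
      split; [exact (check_name M_transitive Hp Hc)|].
      exact (check_value M_transitive Gp Hc).
    + intros Na. apply HN in Na. destruct Na as (t & Mt & _ & Ht).
      exact (set_of_ordinals_in_M M_transitive M_ZF X_in_M les_in_M les_quasi
        G_generic Xs_in_M le_in_M EC LRA ramsey Mt Ht Oa).
  - intros alpha f s Oalpha Ms Hf Nf. apply HN in Nf.
    destruct Nf as (t & Mt & _ & Ht).
    exact (sequence_in_M M_transitive M_ZF X_in_M les_in_M les_quasi
      G_generic Xs_in_M le_in_M EC LRA ramsey Mt Ht Oalpha Ms Hf).
Qed.
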